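(* Let $n \ge 8$ be an even integer and let $s$ be an integer with $s^2 \equiv 1 \pmod n$ and $s \not\equiv \pm 1 \pmod n$. Let $G = \langle x,y \mid x^2 = y^{n/2},\ y^n = 1,\ yx = xy^s\rangle$. Then $${\sf d}(G) = n,\qquad \eta(G) = n+1,\qquad {\sf s}(G) = \begin{cases} 2n & \text{if } n \equiv 0 \pmod 4,\\ 3n & \text{if } n\equiv 2 \pmod 4,\end{cases}\qquad {\sf E}(G) = 3n.$$
   Context: $G$ is a group of order $2n$, with $\exp(G)=n$ if $n\equiv 0 \pmod 4$ and $\exp(G)=2n$ if $n \equiv 2\pmod 4$. A sequence over a finite group $G$ is a finite unordered list of elements of $G$ with repetition allowed (an element of the free abelian monoid on $G$); its length $|S|$ is the number of terms; a subsequence is a sub-multiset. For a sequence $S=g_1\cdots g_k$, $\pi(S)$ is the set of all products $g_{\tau(1)}\cdots g_{\tau(k)}$ over all permutations $\tau$ of $[1,k]$. $S$ is product-one if $1\in\pi(S)$; an $m$-product-one sequence is a product-one sequence of length $m$; a short product-one sequence is a product-one sequence of length between $1$ and $\exp(G)$; $S$ is product-one free if it has no nonempty product-one subsequence. Invariants: ${\sf d}(G)$ is the maximal length of a product-one free sequence over $G$; ${\sf E}(G)$ is the least $\ell$ such that every sequence of length $\ge \ell$ has a $|G|$-product-one subsequence; $\eta(G)$ is the least $\ell$ such that every sequence of length $\ge\ell$ has a short product-one subsequence; ${\sf s}(G)$ is the least $\ell$ such that every sequence of length $\ge \ell$ has an $\exp(G)$-product-one subsequence. *)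

(* Defs.v *)
From mathcomp Require Import all_boot all_order all_algebra all_fingroup all_solvable.
Set Implicit Arguments. Unset Strict Implicit. Unset Printing Implicit Defensive.

(* finite groups. A sequence over G is a list of elements of
   gT all lying in G (the order of the list is irrelevant for every notion
   below, which only uses it up to permutation / sub-multisets). *)

Section ZeroSum.
Variable gT : finGroupType.
Local Open Scope group_scope.

Definition seq_over (G : {set gT}) (S : seq gT) : bool := all (mem G) S.

Definition product_one (S : seq gT) : Prop :=
  exists t : seq gT, perm_eq t S /\ \prod_(g <- t) g = 1.

Definition subseq_of (T S : seq gT) : Prop := exists m : bitseq, T = mask m S.

Definition product_one_free (S : seq gT) : Prop :=
  forall T, subseq_of T S -> size T > 0 -> ~ product_one T.

Definition has_k_product_one (k : nat) (S : seq gT) : Prop :=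
  exists T, subseq_of T S /\ size T = k /\ product_one T.

Definition has_short_product_one (G : {set gT}) (S : seq gT) : Prop :=
  exists T, subseq_of T S /\ 1 <= size T <= exponent G /\ product_one T.

Definition is_davenport (G : {set gT}) (k : nat) : Prop :=
  (exists S, seq_over G S /\ size S = k /\ product_one_free S) /\
  (forall S, seq_over G S -> product_one_free S -> size S <= k).

Definition is_least (P : nat -> Prop) (l : nat) : Prop :=
  P l /\ forall m, P m -> l <= m.

Definition is_E (G : {set gT}) (l : nat) : Prop :=
  is_least (fun l => forall S, seq_over G S -> l <= size S ->
                       has_k_product_one #|G| S) l.

Definition is_eta (G : {set gT}) (l : nat) : Prop :=
  is_least (fun l => forall S, seq_over G S -> l <= size S ->
                       has_short_product_one G S) l.

Definition is_s (G : {set gT}) (l : nat) : Prop :=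
  is_least (fun l => forall S, seq_over G S -> l <= size S ->
                       has_k_product_one (exponent G) S) l.

End ZeroSum.

(* Main.v *)
Require Import Defs.
From mathcomp Require Import all_boot all_order all_algebra all_fingroup all_solvable.
From mathcomp Require Import zify ring.

(* Write the terms of a sequence over G as [y^a] or [x y^a].  As soon as a
   subsequence contains two terms of [x<y>], any product of its terms lying in
   [<y>] may be placed between them, which multiplies its exponent by [s].  The
   upper bounds thus become statements about zero sums in Z/n in which some
   exponents [a] may be replaced by [s a].  It suffices to find a product-one
   subsequence of length n among 2n terms if 4 divides n, and of length 2n among
   3n terms otherwise; the bounds for d and eta follow by appending copies of 1.

   If 4 divides n, the Erdos-Ginzburg-Ziv theorem lifts the claim from a
   quotient of [<y>] of order 2p with [s = -1] modulo the odd prime p, or of order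
   2^f with [s = 1 + 2^(f-1)].
   If n = 2kl with [s = 1] modulo 2k and [s = -1] modulo l, then replacing [a] by
   [s a] only matters modulo l.  Either few exponents are nonzero modulo some divisor
   of l, and pairing the terms solves the problem by Erdos-Ginzburg-Ziv; or the
   replacements realise every residue modulo l, and one only needs a zero sum in the
   cyclic quotient of order 4k containing prescribed terms, which exists unless
   almost all terms lie in a coset of a proper subgroup.

   The lower bounds come from the sequences 1^p y^(n-1) x. *)

(** The engine is a dichotomy. Subset sums modulo [d] grow with each new element until they are
    stable under a subgroup. So either fewer than [d] elements reach every residue, or all but at
    most [e - 2] elements are divisible by some divisor e > 1 of [d]. The second outcome is as
    welcome as the first: when the terms lie in one class modulo a divisor [q] of [n],
    Erdos-Ginzburg-Ziv needs n/q - 1 spare terms instead of n - 1, and this saving pays for the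
    discarded terms. The lift from a quotient needs n/2 even: then two terms of x<y> with exponents
    of equal parity have their product in <y^2>, so pairs of terms live in a group of half the
    order. If n/2 is odd, that product is an odd power of [y]. The cyclic quotient of order 4k takes
    over, since the parity of a class there tells the two cosets of <y> apart, and a zero sum
    automatically has an even number of terms in x<y>. *)

Section Bounds.
Set Implicit Arguments. Unset Strict Implicit. Unset Printing Implicit Defensive.

(* The counting inequalities of [two_mod_four_realizes], where [k = h * k'] and
   [l = 2 * L - 1]. *)

Lemma double_half_product (h k' L : nat) : 2 < h -> 1 < L -> 0 < k' ->
  2 * ((h - 1) * L) + 2 * L <= h * k' * (2 * L).
Proof. by case: h => // h _ L1 k0; nia. Qed.

(** Room for [pairs_case]: of 3n terms at most (h - 1)L lie outside the class modulo [h] and at most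
    e - 2 more are discarded; here n/(eh) = 2k'l'. *)
Lemma bound_pairs (h k' e l' L : nat) : 2 < h * k' -> 2 < e -> odd h -> e * l' = 2 * L - 1 -> 1 < L ->
  4 * (k' * l') + 2 * e + (h - 1) * L <= 2 * (h * k' * (e * l')) + 3.
Proof.
move=> hk e3 oh el L1.
have k0 : 0 < k' by case: k' hk => //; rewrite muln0.
have l0 : 0 < l' by case: l' el => //; rewrite muln0; lia.
have le_e : e <= e * l' by rewrite leq_pmulr.
have [h1|h3] : h = 1 \/ 2 < h by move: oh hk; case: h => [|[|[|h]]] //; [left|right].
  rewrite h1 subnn mul0n addn0 mul1n in hk *.
  have : 3 * (e * l') <= k' * (e * l') by rewrite leq_mul2r hk orbT.
  have : 3 * (k' * l') <= e * (k' * l') by rewrite leq_mul2r e3 orbT.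
  have : e * (k' * l') = k' * (e * l') by lia.
  by lia.
have := double_half_product h3 L1 k0.
have P1 : 3 * (e * l') <= h * k' * (e * l') by rewrite leq_mul2r hk orbT.
have P2 : 3 * (3 * (k' * l')) <= h * (e * (k' * l')).
  by rewrite leq_mul // leq_mul2r e3 orbT.
have P3 : h * (e * (k' * l')) = h * k' * (e * l') by lia.
have P4 : h * k' * (2 * L) = h * k' * (e * l') + h * k' by rewrite el; nia.
have P5 : 3 * (h * k') <= h * k' * (e * l') by rewrite mulnC leq_mul2l; apply/orP; right; apply: leq_trans le_e.
by lia.
Qed.

(** Room for [noncoset_case] on the class modulo [h], where n/h = 2k'l. *)
Lemma bound_noncoset (h k' L : nat) : 2 < h -> 1 < L -> 0 < k' ->
  2 * (k' * (2 * L - 1)) + (h - 1) * L <= 2 * (h * k' * (2 * L - 1)) + 1.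
Proof.
move=> h3 L1 k0; have := double_half_product h3 L1 k0.
set l := 2 * L - 1; have lE : 2 * L = l.+1 by rewrite /l; lia.
have P1 : 3 * (k' * l) <= h * (k' * l) by rewrite leq_mul2r h3 orbT.
have P2 : h * k' <= h * k' * l by rewrite leq_pmulr // /l; lia.
by rewrite lE !mulnS -!mulnA in P2 *; lia.
Qed.

(** Room for [fixed_size_sums_dichotomy] modulo 4k' once at most [l] prescribed terms are set
    aside. *)
Lemma bound_sums (h k' L : nat) : 2 < h * k' -> odd h -> 1 < L ->
  12 * k' + (h - 1) * L + 2 * L <= 6 * (h * k' * (2 * L - 1)) /\
  4 * k' + (h - 1) * L <= 2 * (h * k' * (2 * L - 1)).
Proof.
move=> hk oh L1; have k0 : 0 < k' by case: k' hk => //; rewrite muln0.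
set l := 2 * L - 1; have lE : 2 * L = l.+1 by rewrite /l; lia.
have l3 : 3 <= l by rewrite /l; lia.
have P1 : 3 * (h * k') <= h * k' * l by rewrite mulnC leq_mul2l l3 orbT.
have P2 : 3 * l <= h * k' * l by rewrite leq_mul2r hk orbT.
have [h1|h3] : h = 1 \/ 2 < h by move: oh hk; case: h {P1 P2} => [|[|[|h]]] //; [left|right].
  by move: P1 P2; rewrite h1 subnn mul0n addn0 mul1n; lia.
have P3 : 3 * k' <= h * k' by rewrite leq_mul2r h3 orbT.
by have := double_half_product h3 L1 k0; rewrite lE mulnS; lia.
Qed.

(** Contradicts the maximality of [h]. Equality holds for h = 1 and e = 3, so no smaller weight than
    L = (l + 1)/2 would do. *)
Lemma bound_odd_index (h e L : nat) : 0 < h -> 2 < e -> 1 < L ->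
  (h - 1) * L + 2 * L + e <= (h * e - 1) * L + 3.
Proof. by case: h => // h _; case: e => [|[|[|e]]] // _ L1; rewrite !subn1 /=; nia. Qed.

(** Room for [pairs_case] with [l] in place of [e] and he/2 in place of [h], so that the index n/(l
    * he/2) is [y]. *)
Lemma bound_even_coset (h k' e y L : nat) : 2 < h * k' -> odd h -> 1 < L -> e * y = 4 * k' -> 1 < e ->
  2 * y + 2 * (2 * L - 1) + (h - 1) * L + e <= 2 * (h * k' * (2 * L - 1)) + 3.
Proof.
move=> hk oh L1 ey e2; have k0 : 0 < k' by case: k' hk {ey} => //; rewrite muln0.
have y0 : 0 < y by case: y ey => //; rewrite muln0; lia.
have ey2 : e + 2 * y <= e * y + 2 by case: e e2 {ey} => [|[|e]] // _; nia.
set l := 2 * L - 1; have lE : 2 * L = l.+1 by rewrite /l; lia.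
have l3 : 3 <= l by rewrite /l; lia.
have P1 : 3 * (h * k') <= h * k' * l by rewrite mulnC leq_mul2l l3 orbT.
have P2 : 3 * l <= h * k' * l by rewrite leq_mul2r hk orbT.
have [h1|h3] : h = 1 \/ 2 < h by move: oh hk; case: h {P1 P2} => [|[|[|h]]] //; [left|right].
  rewrite h1 mul1n in hk *; rewrite subnn mul0n addn0.
  have : (k' - 1) * (l - 2) >= 2 by nia.
  by nia.
have P3 : 3 * k' <= h * k' by rewrite leq_mul2r h3 orbT.
by have := double_half_product h3 L1 k0; rewrite lE mulnS; lia.
Qed.

(** For h = 1 and e = 2 one has yl = n and the inequality fails; the caller rules this out by the
    presence of two terms in x<y>. *)
Lemma bound_even_noncoset (h k' e y L : nat) : 2 < h * k' -> odd h -> 1 < L -> e * y = 4 * k' -> 1 < e -> ~~ odd e ->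
   ~~ ((h == 1) && (e == 2)) ->
  y * (2 * L - 1) + (h - 1) * L + (2 * L - 1) + e <= 2 * (h * k' * (2 * L - 1)) + 3.
Proof.
move=> hk oh L1 ey e2 oe he; have k0 : 0 < k' by case: k' hk {ey} => //; rewrite muln0.
have y0 : 0 < y by case: y ey => //; rewrite muln0; lia.
set l := 2 * L - 1; have lE : 2 * L = l.+1 by rewrite /l; lia.
have l3 : 3 <= l by rewrite /l; lia.
have P1 : 3 * (h * k') <= h * k' * l by rewrite mulnC leq_mul2l l3 orbT.
have P2 : 3 * l <= h * k' * l by rewrite leq_mul2r hk orbT.
have [h1|h3] : h = 1 \/ 2 < h by move: oh hk; case: h {P1 P2 he} => [|[|[|h]]] //; [left|right].
  rewrite h1 mul1n in hk he *; rewrite subnn mul0n addn0.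
  have e4 : 4 <= e by move: e2 oe he; case: e {ey} => [|[|[|[|]]]].
  have ey4 : e + 4 * y <= e * y + 4 by case: e e4 {e2 oe he ey} => [|[|[|[|e]]]] // _; nia.
  have yk : y <= k' by nia.
  have : y * l <= k' * l by rewrite leq_mul2r yk orbT.
  have : 3 * k' <= k' * l by rewrite mulnC leq_mul2l l3 orbT.
  have : 3 * l <= k' * l by rewrite leq_mul2r hk orbT.
  have : (k' - y) * (l - 3) >= 0 by [].
  have : e + y * l <= k' * l + 4 + k' - y by nia.
  by lia.
have P3 : 3 * k' <= h * k' by rewrite leq_mul2r h3 orbT.
have P4 : 3 * (k' * l) <= h * (k' * l) by rewrite leq_mul2r h3 orbT.
have P5 : y * l <= 2 * k' * l by rewrite leq_mul2r; apply/orP; right; nia.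
have P6 : e <= 4 * k' by rewrite -ey leq_pmulr.
by have := double_half_product h3 L1 k0; rewrite lE mulnS; rewrite -!mulnA in P1 P2 P5 *; lia.
Qed.

End Bounds.

Section ZeroSums.
Import Order.TTheory GRing.Theory Num.Theory.
Local Open Scope ring_scope.
Set Implicit Arguments. Unset Strict Implicit. Unset Printing Implicit Defensive.

Ltac dvz := solve [ assumption | apply: dvdz_mulr; dvz | apply: dvdz_mull; dvz
  | apply: rpredD; dvz | apply: rpredB; dvz | rewrite rpredN; dvz | apply: rpred_sum; auto ].

(** * Subset sums modulo an integer *)

Section SubsetSums.
Variable I : finType.
Implicit Types (f : I -> int) (U V T J F : {set I}) (t c g : int) (d e : nat).

Definition hits d f F t : bool :=
  [exists J : {set I}, (J \subset F) && (d %| \sum_(i in J) f i - t)%Z].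

Definition residues d f F : {set 'I_d} := [set z : 'I_d | hits d f F (z : nat)%:Z].

Definition period d f F c : Prop := forall t, hits d f F t -> hits d f F (t + c).

Lemma hitsP d f F t :
  reflect (exists2 J : {set I}, J \subset F & (d %| \sum_(i in J) f i - t)%Z)
          (hits d f F t).
Proof. by apply: (iffP existsP) => [[J /andP[]]|[J JF Jt]]; exists J; rewrite // JF. Qed.

Lemma hits_eqmod d f F t c : (d %| t - c)%Z -> hits d f F t -> hits d f F c.
Proof.
move=> dtc /hitsP[J JF Jt]; apply/hitsP; exists J => //.
have -> : \sum_(i in J) f i - c = (\sum_(i in J) f i - t) + (t - c) by ring.
exact: rpredD.
Qed.

Lemma hits0 d f F : hits d f F 0.
Proof. by apply/hitsP; exists set0; rewrite ?sub0set // big_set0 subrr dvdz0. Qed.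

Lemma sub_hits d f F U t : F \subset U -> hits d f F t -> hits d f U t.
Proof. by move=> FU /hitsP[J JF Jt]; apply/hitsP; exists J => //; apply: subset_trans FU. Qed.

Lemma residueE d t : (0 < d)%N -> exists z : 'I_d, (d %| t - (z : nat)%:Z)%Z.
Proof.
move=> d0; have d0' : (d : int) != 0 by lia.
have lt : (`|(t %% d)%Z| < d)%N by have := ltz_mod t d0'; have := modz_ge0 t d0'; lia.
exists (Ordinal lt) => /=; rewrite gez0_abs ?modz_ge0 //.
by rewrite {1}(divz_eq t d) addrK dvdz_mull.
Qed.

Lemma hits_residues d f F U : (0 < d)%N ->
  residues d f U \subset residues d f F -> forall t, hits d f U t -> hits d f F t.
Proof.
move=> d0 /subsetP sub t Ut; have [z dz] := residueE t d0.
have : z \in residues d f U by rewrite inE; apply: hits_eqmod Ut.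
by move/sub; rewrite inE; apply: hits_eqmod; rewrite -opprB rpredN.
Qed.

Lemma hits_setU1 d f F i t : i \notin F -> hits d f F t -> hits d f (i |: F) (t + f i).
Proof.
move=> iF /hitsP[J JF Jt]; apply/hitsP; exists (i |: J); first by rewrite setUS.
have iJ : i \notin J by apply: contra iF => /(subsetP JF).
rewrite big_setU1 //= (_ : _ - _ = \sum_(i in J) f i - t) //; by ring.
Qed.

(* A maximal admissible set on which the number of hit residues grows with every
   element: no further admissible element can enlarge the hit set, so its value
   is a period. *)
Lemma greedy d f (P : pred {set I}) : (0 < d)%N -> P set0 ->
  exists F, [/\ P F, (#|F| < #|residues d f F|)%N
    & forall i, i \notin F -> P (i |: F) -> period d f F (f i)].
Proof.
move=> d0 P0; pose Q F := P F && (#|F| < #|residues d f F|)%N.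
have Q0 : Q set0.
  rewrite /Q P0 cards0 card_gt0; apply/set0Pn; exists (Ordinal d0).
  by rewrite inE; apply: hits0.
case: (@arg_maxnP _ set0 Q (fun F : {set I} => #|F|) Q0) => F /andP[PF ltF] maxF.
exists F; split=> // i iF PiF t Ft.
have sub : residues d f F \subset residues d f (i |: F).
  by apply/subsetP=> z; rewrite !inE; apply: sub_hits; apply: subsetUr.
have eqr : residues d f F = residues d f (i |: F).
  apply/eqP; rewrite eqEcard sub leqNgt; apply/negP => lt.
  have /maxF : Q (i |: F).
    by rewrite /Q PiF cardsU1 iF /=; apply: leq_ltn_trans lt.
  by rewrite cardsU1 iF /= ltnn.
by apply: (@hits_residues _ _ _ (i |: F)) => //; rewrite ?eqr //; apply: hits_setU1.
Qed.

Lemma periodM d f F c (k : nat) : period d f F c -> period d f F (c *+ k).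
Proof.
move=> pc; elim: k => [|k IHk] t Ft; first by rewrite mulr0n addr0.
by rewrite mulrS addrA; apply: IHk; apply: pc.
Qed.

Lemma periodZ d f F c (m : int) : (0 < d)%N -> period d f F c -> period d f F (c * m).
Proof.
move=> d0 pc t Ft; have d0' : (d : int) != 0 by lia.
have := periodM `|(m %% d)%Z| pc Ft; apply: hits_eqmod.
rewrite -mulr_natr; set w := (_ %:R : int).
have -> : w = (m %% d)%Z by rewrite /w natz gez0_abs ?modz_ge0.
have -> : t + c * (m %% d)%Z - (t + c * m) = - (c * (m %/ d)%Z) * d.
  by rewrite {2}(divz_eq m d); ring.
exact: dvdz_mull.
Qed.

(** The periods form a subgroup of the integers containing [d]. By Bezout the gcd of [u] with any
    period is again a period dividing [d], so minimality makes [u] a generator. *)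
Lemma least_period d f F : (0 < d)%N ->
  exists u : nat, [/\ (u %| d)%N, (0 < u)%N, period d f F u
    & forall c, period d f F c -> (u %| c)%Z].
Proof.
move=> d0; pose perb (u : nat) := [forall z : 'I_d, hits d f F (z : nat)%:Z ==> hits d f F ((z : nat)%:Z + u%:Z)].
have perP (u : nat) : reflect (period d f F u) (perb u).
  apply: (iffP forallP) => [H t Ft|H z]; last by apply/implyP => /H.
  have [z dz] := residueE t d0.
  have /implyP/(_ (hits_eqmod dz Ft)) := H z; apply: hits_eqmod.
  by rewrite opprD addrACA subrr addr0 -opprB rpredN.
have ex_u : exists u, [&& u %| d, 0 < u & perb u]%N.
  exists d; rewrite dvdnn d0; apply/perP => t.
  by apply: hits_eqmod; rewrite opprD addrA subrr sub0r rpredN.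
case: (ex_minnP ex_u) => u /and3P[ud u0 /perP pu] minu; exists u; split=> // c pc.
have [a [b ab]] := Bezoutz u c.
have pg : period d f F (gcdz u c).
  by move=> t Ft; rewrite -ab addrA (mulrC a) (mulrC b); do 2!apply: periodZ => //.
have /minu le_ug : [&& gcdn u `|c| %| d, 0 < gcdn u `|c| & perb (gcdn u `|c|)]%N.
  by rewrite (dvdn_trans (dvdn_gcdl _ _) ud) gcdn_gt0 u0; apply/perP.
rewrite dvdzE /=; suff /eqP -> : u == gcdn u `|c| by apply: dvdn_gcdr.
by rewrite eqn_leq le_ug dvdn_leq // dvdn_gcdl.
Qed.

Lemma period1_hits d f F t : (0 < d)%N -> period d f F 1 -> hits d f F t.
Proof. by move=> d0 /(periodZ t d0)/(_ _ (hits0 d f F)); rewrite add0r mul1r. Qed.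

(* If no subset sum of [U] misses a residue we are done; otherwise the least
   period [u] of the hit set divides all the elements of [U] outside a small
   set, and we descend from [d] to [u]. *)
Lemma subset_sums_dichotomy d f U : (0 < d)%N ->
  (exists e : nat, [/\ (e %| d)%N, (1 < e)%N & (#|[set i in U | ~~ (e %| f i)%Z]| + 2 <= e)%N])
  \/ (exists F, [/\ F \subset U, (#|F| < d)%N & forall t, hits d f F t]).
Proof.
elim/ltn_ind: d => d IHd d0.
have [F [FU ltF perF]] := @greedy d f (fun F => F \subset U) d0 (sub0set U).
have [u [ud u0 pu minu]] := least_period f F d0.
have uf i : i \in U -> i \notin F -> (u %| f i)%Z.
  by move=> iU iF; apply: minu; apply: perF; rewrite // subUset sub1set iU.
have ltFd : (#|F| < d)%N.
  by apply: leq_trans ltF _; rewrite -[X in (_ <= X)%N]card_ord max_card.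
have subE : [set i in U | ~~ (u %| f i)%Z] \subset F.
  by apply/subsetP => i; rewrite inE => /andP[iU]; apply: contraR => /(uf i iU).
have [u1|u_gt1] := leqP u 1.
  right; exists F; split=> // t; apply: period1_hits => //.
  have u1' : u = 1%N by lia.
  by rewrite u1' in pu.
have [eq_ud|ne_ud] := eqVneq u d.
  have [full|nfull] := boolP (residues d f F == setT).
    right; exists F; split=> // t.
    have [z dz] := residueE t d0; have : z \in residues d f F by rewrite (eqP full) inE.
    by rewrite inE; apply: hits_eqmod; rewrite -opprB rpredN.
  (* [F] has fewer elements than residues hit, and some residue is missed: at most d - 2
     elements. *)
  left; exists d; rewrite dvdnn -{1}eq_ud u_gt1; split=> //.
  apply: leq_trans (_ : #|F| + 2 <= d)%N; first by rewrite leq_add2r -eq_ud subset_leq_card.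
  have : (#|residues d f F| < #|[set: 'I_d]|)%N by rewrite proper_card // properT.
  by rewrite cardsT card_ord; lia.
have lt_ud : (u < d)%N by rewrite ltn_neqAle ne_ud dvdn_leq.
case: (IHd u lt_ud u0) => [[e [eu e1 le_e]]|[F' [F'U _ hitF']]].
  by left; exists e; split=> //; apply: dvdn_trans ud.
right; exists F; split=> // t.
(* The part of [J] outside [F] has a sum divisible by [u], so [t] differs from the sum over
   [J :&: F] by a multiple of a period of [F]. *)
have /hitsP[J JF' Jt] := hitF' t.
have FJ : hits d f F (\sum_(i in J :&: F) f i).
  by apply/hitsP; exists (J :&: F); rewrite ?subsetIr // subrr dvdz0.
have /dvdzP[q tq] : (u %| t - \sum_(i in J :&: F) f i)%Z.
  have -> : t - \sum_(i in J :&: F) f i = \sum_(i in J :\: F) f i - (\sum_(i in J) f i - t).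
    have -> : \sum_(i in J) f i = \sum_(i in J :&: F) f i + \sum_(i in J :\: F) f i.
      by rewrite (big_setID F).
    by ring.
  apply: rpredB => //; apply: rpred_sum => i; rewrite inE => /andP[iF iJ].
  by apply: uf; rewrite // (subsetP F'U) // (subsetP JF').
by have := periodZ q d0 pu FJ; rewrite mulrC -tq addrC subrK.
Qed.
End SubsetSums.

(** * Subset sums with a prescribed number of terms *)

Section FixedSizeSums.
Variable I : finType.
Implicit Types (f : I -> int) (U V T J F : {set I}) (t c g : int) (d e : nat).

Lemma subset_of_size (A : {set I}) (m : nat) : (m <= #|A|)%N ->
  exists2 B : {set I}, B \subset A & #|B| = m.
Proof.
move=> le_m; exists [set i in take m (enum A)].
  by apply/subsetP => i; rewrite inE => /mem_take; rewrite mem_enum.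
by rewrite cardsE (card_uniqP _) ?take_uniq ?enum_uniq // size_takel // -cardE.
Qed.

(** The hit set is a union of classes modulo [u], so missing one residue means missing its whole
    class, of d/u residues. *)
Lemma card_residues_period (J : finType) d (f : J -> int) (F : {set J}) (u : nat) : (0 < d)%N -> (u %| d)%N ->
  period d f F u -> residues d f F != setT -> (#|residues d f F| + d %/ u <= d)%N.
Proof.
move=> d0 ud pu; rewrite -properT => /properP[_ [z _ zX]].
have u0 : (0 < u)%N by apply: dvdn_gt0 ud.
have lt (j : 'I_(d %/ u)) : (z %% u + u * j < d)%N.
  have := ltn_ord j; have := ltn_pmod z u0; rewrite -{3}(divnK ud); nia.
pose phi j := Ordinal (lt j).
have inj_phi : injective phi.
  move=> j1 j2 /(congr1 val) /= /addnI /eqP; rewrite eqn_pmul2l // => /eqP; exact: val_inj.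
have sub : phi @: setT \subset ~: residues d f F.
  apply/subsetP => _ /imsetP[j _ ->]; rewrite inE; apply: contra zX.
  rewrite !inE /= => /(periodZ ((z %/ u)%N%:Z - (j : nat)%:Z) d0 pu); apply: hits_eqmod.
  set w := (_ - _ : int); suff -> : w = 0 by exact: dvdz0.
  by rewrite /w {3}(divn_eq z u) !PoszD !PoszM; ring.
have := subset_leq_card sub; rewrite card_imset // cardsT card_ord.
have := cardsC (residues d f F); rewrite card_ord => A B.
by rewrite -[X in (_ <= X)%N]A leq_add2l.
Qed.

(** The cardinalities say that both projections are injective on [Q]. Choosing one entry of each
    pair then always gives [#|Q|] elements, and switching a pair changes the sum by the difference
    of its entries. *)
Definition matching V (Q : {set I * I}) : bool :=
  [&& [set p.1 | p in Q] :|: [set p.2 | p in Q] \subset V,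
      #|[set p.1 | p in Q]| == #|Q|, #|[set p.2 | p in Q]| == #|Q|
    & [disjoint [set p.1 | p in Q] & [set p.2 | p in Q]]].

Lemma matching_choice V (Q J : {set I * I}) f : matching V Q -> J \subset Q ->
  exists T, [/\ T \subset [set p.1 | p in Q] :|: [set p.2 | p in Q], #|T| = #|Q|
   & \sum_(i in T) f i = \sum_(p in Q) f p.1 + \sum_(p in J) (f p.2 - f p.1)].
Proof.
case/and4P=> _ /imset_injP inj1 /imset_injP inj2 dis JQ.
exists ([set p.2 | p in J] :|: [set p.1 | p in Q :\: J]).
have dis' : [disjoint [set p.2 | p in J] & [set p.1 | p in Q :\: J]].
  rewrite disjoint_sym; apply: disjointWl (imsetS _ (subsetDl Q J)) _.
  exact: disjointWr (imsetS _ JQ) dis.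
have inj1' : {in Q :\: J &, injective (fun p : I * I => p.1)}.
  by apply: sub_in2 inj1 => p; rewrite inE => /andP[].
have inj2' : {in J &, injective (fun p : I * I => p.2)} by apply: sub_in2 inj2; apply/subsetP.
split.
- by rewrite setUC; apply: setUSS; apply: imsetS; rewrite ?subsetDl.
- have := cardsUI [set p.2 | p in J] [set p.1 | p in Q :\: J].
  move: (dis'); rewrite -setI_eq0 => /eqP ->; rewrite cards0 addn0 => ->.
  by rewrite !card_in_imset // -[in RHS](cardsID J Q) (setIidPr JQ).
rewrite (eq_bigl [predU [set p.2 | p in J] & [set p.1 | p in Q :\: J]]) => [|i]; last by rewrite !inE.
rewrite bigU //= big_imset //= big_imset //=.
have -> : \sum_(p in Q) f p.1 = \sum_(p in J) f p.1 + \sum_(p in Q :\: J) f p.1.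
  by rewrite (big_setID J) /= (setIidPr JQ).
by rewrite sumrB; ring.
Qed.

(* A maximal matching on which the number of subset sums of the differences grows
   with every pair: the differences of unmatched elements are periods. *)
Lemma matching_dichotomy V d f : (0 < d)%N -> exists Q, [/\ matching V Q, (#|Q| < d)%N
  & (forall t, hits d (fun p => f p.2 - f p.1) Q t) \/
    exists (u : nat) g, [/\ (u %| d)%N, (1 < u)%N
      & (#|[set i in V | ~~ (u %| (f i - g)%R)%Z]| + 2 + 2 * (d %/ u) <= 2 * d)%N]].
Proof.
move=> d0; pose D (p : I * I) := f p.2 - f p.1.
have M0 : matching V set0.
  by rewrite /matching !imset0 setU0 sub0set !cards0 eqxx -setI_eq0 setI0 eqxx.
have [Q [MQ ltQ perQ]] := @greedy _ d D (matching V) d0 M0.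
have [u [ud u0 pu minu]] := least_period D Q d0.
exists Q; split=> //.
  by apply: leq_trans ltQ _; rewrite -[X in (_ <= X)%N]card_ord max_card.
have [u1|u_gt1] := leqP u 1.
  left=> t; apply: period1_hits => //.
  have u1' : u = 1%N by lia.
  by rewrite u1' in pu.
have [full|nfull] := boolP (residues d D Q == setT).
  left=> t; have [z dz] := residueE t d0; have : z \in residues d D Q by rewrite (eqP full) inE.
  by rewrite inE; apply: hits_eqmod; rewrite -opprB rpredN.
right; exists u.
pose Cv := [set p.1 | p in Q] :|: [set p.2 | p in Q].
have cardC : (#|Cv| <= 2 * #|Q|)%N.
  rewrite /Cv mul2n -addnn; apply: leq_trans (leq_addr #|[set p.1 | p in Q] :&: [set p.2 | p in Q]| _) _.
  by rewrite cardsUI leq_add // leq_imset_card.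
(* An unmatched element provides [g]; if all of [V] is matched, every element may be an exception
   and any [g] will do. *)
have [g sub] : exists g, [set i in V | ~~ (u %| f i - g)%Z] \subset Cv.
  have [VC|/subsetPn[i0 i0V i0C]] := boolP (V \subset Cv).
    by exists 0; apply: subset_trans VC; apply/subsetP => i; rewrite inE => /andP[].
  exists (f i0); apply/subsetP => i; rewrite inE => /andP[iV]; apply: contraR => iC.
  have [->|ne] := eqVneq i i0; first by rewrite subrr dvdz0.
  apply: (minu (D (i0, i))); apply: perQ.
    apply: contra iC => iQ; apply/setUP; right; by apply/imsetP; exists (i0, i).
  case/and4P: MQ => sQ c1 c2 dis.
  have Q0 : (i0, i) \notin Q.
    apply: contra iC => iQ; apply/setUP; right; by apply/imsetP; exists (i0, i).
  move: i0C iC; rewrite /Cv !inE !negb_or => /andP[i01 i02] /andP[i1 i2].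
  rewrite /matching !imsetU !imset_set1 /= !cardsU1 Q0 i01 i2 !eqSS c1 c2 /=; apply/andP; split.
    by rewrite setUACA subUset sQ andbT; apply/subsetP => j; rewrite !inE => /orP[]/eqP->.
  apply/pred0P => j /=; rewrite !in_setU1.
  have [->|_] := eqVneq j i0; first by rewrite (negPf i02) eq_sym (negPf ne).
  have [->|_] := eqVneq j i; first by rewrite (negPf i1).
  by move/pred0P: dis => /(_ j).
exists g; split=> //.
have := subset_leq_card sub; have := card_residues_period d0 ud pu nfull.
have := divn_gt0 d u0; have := dvdn_leq d0 ud; lia.
Qed.

Lemma big_disjointU (A B : {set I}) f : [disjoint A & B] ->
  \sum_(i in A :|: B) f i = \sum_(i in A) f i + \sum_(i in B) f i.
Proof.
move=> dis; rewrite (eq_bigl [predU A & B]) => [|i]; last by rewrite !inE.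
by rewrite bigU.
Qed.

Lemma cards_disjointU (A B : {set I}) : [disjoint A & B] -> #|A :|: B| = (#|A| + #|B|)%N.
Proof. by rewrite -setI_eq0 => /eqP AB; rewrite -cardsUI AB cards0 addn0. Qed.

(* The largest [h] dividing [d] such that most of [V] lies in one class modulo [h]:
   matched pairs inside that class realise all the multiples of [h], and the
   exceptional elements realise all the classes modulo [h] unless most of [V] lies
   in one class modulo some [e] in the sharper sense of the conclusion. *)
Lemma fixed_size_sums_dichotomy V d (r : nat) f :
    (0 < d)%N -> (d <= r + 1)%N -> (d + r <= #|V| + 1)%N -> (3 * d <= #|V| + 3)%N ->
  (forall t, exists T, [/\ T \subset V, #|T| = r & (d %| \sum_(i in T) f i - t)%Z]) \/
  (exists (e : nat) g, [/\ (e %| d)%N, (1 < e)%N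
     & (#|[set i in V | ~~ (e %| (f i - g)%R)%Z]| + 2 <= e)%N]).
Proof.
move=> d0 le_dr le_drV le_3d.
(* The allowance 2d - 2d/h telescopes: applying [matching_dichotomy] modulo d/h to the class costs
   at most 2d/h - 2d/(hu) further exceptions, so [h * u] is good again. *)
pose good h := (h %| d)%N && [exists g : 'I_d,
  (#|[set i in V | ~~ (h %| (f i - (g : nat)%:Z)%R)%Z]| + 2 * (d %/ h) <= 2 * d)%N].
have good1 : exists h, good h.
  exists 1%N; rewrite /good dvd1n /=; apply/existsP; exists (Ordinal d0).
  rewrite (_ : [set _ in _ | _] = set0) ?cards0 ?divn1 //.
  by apply/setP => i; rewrite !inE dvd1z andbF.
have le_good h : good h -> (h <= d)%N by case/andP => /dvdn_leq ->.
case: (ex_maxnP good1 le_good) => h /andP[hd /existsP[g' card_h]] max_h.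
move: {g'}(g' : nat)%:Z card_h => g card_h.
have h0 : (0 < h)%N by apply: dvdn_gt0 hd.
have dh0 : (0 < d %/ h)%N by rewrite divn_gt0 // dvdn_leq.
have dE : d = (d %/ h * h)%N by rewrite divnK.
pose E := [set i in V | ~~ (h %| (f i - g)%R)%Z].
pose Vg := [set i in V | (h %| (f i - g)%R)%Z].
have cardV : (#|E| + #|Vg| = #|V|)%N.
  rewrite -(cardsID Vg V) addnC; congr (_ + _)%N; apply: eq_card => i; rewrite !inE.
    by case: (i \in V).
  by case: (i \in V); rewrite ?andbF ?andbT.
pose f' i := ((f i - g) %/ h)%Z.
have fE i : i \in Vg -> f i = f' i * h + g.
  by rewrite inE => /andP[_ hi]; rewrite /f' divzK // subrK.
have [Q [MQ ltQ]] := matching_dichotomy Vg f' dh0.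
case=> [hitQ|[u [g1 [udh u1 card_u]]]]; last first.
  exfalso; have : good (h * u)%N.
    apply/andP; split; first by rewrite [X in (_ %| X)%N]dE mulnC dvdn_mul.
    have [z dz] := residueE (g + g1 * h) d0; apply/existsP; exists z.
    have hud : (h * u %| d)%N by rewrite [X in (_ %| X)%N]dE mulnC dvdn_mul.
    have sub : [set i in V | ~~ ((h * u)%N %| (f i - (z : nat)%:Z)%R)%Z]
       \subset E :|: [set i in Vg | ~~ (u %| (f' i - g1)%R)%Z].
      apply/subsetP => i; rewrite inE => /andP[iV hi]; rewrite inE.
      have [iVg|] := boolP (i \in Vg); last by rewrite !inE iV /= => ->.
      apply/orP; right; rewrite inE iVg; apply: contra hi => ui.
      have -> : f i - (z : nat)%:Z = (f' i - g1) * h + (g + g1 * h - (z : nat)%:Z).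
        by rewrite (fE _ iVg); ring.
      apply: rpredD; first by rewrite mulnC PoszM dvdz_mul.
      exact: dvdz_trans dz.
    have := leq_trans (subset_leq_card sub) (leq_card_setU _ _).
    rewrite divnMA; move: card_u card_h; rewrite -/E; lia.
  by move/max_h; nia.
case: (subset_sums_dichotomy (fun i => f i - g) E h0) => [[e [eh e1 card_e]]|[F [FE ltF hitF]]].
  right; exists e, g; split=> //; first exact: dvdn_trans hd.
  apply: leq_trans card_e; rewrite leq_add2r subset_leq_card //.
  apply/subsetP => i; rewrite !inE => /andP[iV ei]; rewrite iV ei andbT /=.
  by apply: contra ei; apply: dvdz_trans.
left=> t; pose Cv := [set p.1 | p in Q] :|: [set p.2 | p in Q].
have CvV : Cv \subset Vg by case/and4P: MQ.
have cardCv : #|Cv| = (2 * #|Q|)%N.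
  by case/and4P: MQ => _ /eqP c1 /eqP c2 dis; rewrite cards_disjointU // c1 c2 mul2n addnn.
have cardEF : #|E :\: F| = (#|E| - #|F|)%N by rewrite cardsD (setIidPr FE).
have leF := subset_leq_card FE.
have dhh : (d %/ h + h <= d + 1)%N by rewrite [X in (_ <= X + 1)%N]dE; nia.
have cE : (#|E| + 2 * (d %/ h) <= 2 * d)%N by [].
(* Padding from the exceptional elements, used when the class modulo [h] is too small: with this
   many, [r] terms can be completed from unmatched elements of [Vg] whatever [J] turns out to be. *)
have [E0 E0E cardE0] : exists2 E0 : {set I}, E0 \subset E :\: F & #|E0| = (r + #|Q| - #|Vg|)%N.
  by apply: subset_of_size; rewrite cardEF; lia.
(* [J] settles the sum modulo [h]; since exactly [r] terms will be used, [g] contributes [g *+ r].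
   The matched pairs later correct the rest, a multiple of [h]. *)
have [J JF hJ] := hitsP _ _ _ _ (hitF (t - \sum_(i in E0) (f i - g) - g *+ r)).
have leJ := subset_leq_card JF.
have lerJ : (#|J| + #|E0| + #|Q| <= r)%N.
  by rewrite cardE0; move: leJ leF ltF ltQ dhh cE cardV le_dr le_drV le_3d; clear; lia.
have [R RV cardR] : exists2 R : {set I}, R \subset Vg :\: Cv & #|R| = (r - #|J| - #|E0| - #|Q|)%N.
  by apply: subset_of_size; rewrite cardsD (setIidPr CvV) cardCv; lia.
have dJE : [disjoint J & E0].
  by rewrite disjoint_sym; apply: disjointWl E0E (disjointWr JF _); rewrite disjoints_subset subsetDr.
have disVE : [disjoint E & Vg].
  by rewrite -setI_eq0; apply/eqP/setP => i; rewrite !inE; case: (i \in V); case: (_ %| _)%Z.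
have JE0 : J :|: E0 \subset E by rewrite subUset (subset_trans JF FE) (subset_trans E0E) // subsetDl.
have RVg : R \subset Vg by apply: subset_trans RV _; apply: subsetDl.
pose B := \sum_(i in J) f i + \sum_(i in E0) f i + \sum_(i in R) f i + \sum_(p in Q) f p.1.
have hB : (h %| t - B)%Z.
  have RE : \sum_(i in R) f i = (\sum_(i in R) f' i) * h + g *+ #|R|.
    rewrite mulr_suml -sumr_const -big_split; apply: eq_bigr => i iR.
    by rewrite fE // (subsetP RVg).
  have QE : \sum_(p in Q) f p.1 = (\sum_(p in Q) f' p.1) * h + g *+ #|Q|.
    rewrite mulr_suml -sumr_const -big_split; apply: eq_bigr => p pQ.
    by rewrite fE // (subsetP CvV) // inE; apply/orP; left; apply/imsetP; exists p.
  move: hJ; rewrite !sumrB !sumr_const => hJ.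
  have -> : t - B = - (\sum_(i in J) f i - g *+ #|J| - (t - (\sum_(i in E0) f i - g *+ #|E0|) - g *+ r))
      - (\sum_(i in R) f' i + \sum_(p in Q) f' p.1) * h.
    rewrite /B RE QE.
    have -> : r = (#|J| + #|E0| + #|R| + #|Q|)%N by rewrite cardR; move: lerJ; clear; lia.
    by rewrite !mulrnDr; ring.
  by rewrite rpredB ?rpredN ?dvdz_mull.
have /dvdzP[q qE] := hB.
have [JQ JQQ dJQ] := hitsP _ _ _ _ (hitQ q).
have [T0 [T0C cardT0 sumT0]] := matching_choice f MQ JQQ.
have T0V : T0 \subset Vg by apply: subset_trans CvV.
have dRT : [disjoint R & T0].
  apply: disjointWl RV (disjointWr T0C _).
  by rewrite disjoints_subset subsetDr.
have dall : [disjoint J :|: E0 & R :|: T0].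
  by apply: disjointWl JE0 (disjointWr _ disVE); rewrite subUset RVg.
exists (J :|: E0 :|: (R :|: T0)); split.
- rewrite subUset; apply/andP; split.
    by apply: subset_trans JE0 _; apply/subsetP => i; rewrite inE => /andP[].
  by rewrite subUset; apply/andP; split; [apply: subset_trans RVg _|apply: subset_trans T0V _];
     apply/subsetP => i; rewrite inE => /andP[].
- rewrite (cards_disjointU dall) (cards_disjointU dJE) (cards_disjointU dRT) cardR cardT0.
  by move: lerJ; clear; lia.
rewrite (big_disjointU f dall) (big_disjointU f dJE) (big_disjointU f dRT) sumT0.
have -> : \sum_(p in JQ) (f p.2 - f p.1) = (\sum_(p in JQ) (f' p.2 - f' p.1)) * h.
  rewrite mulr_suml; apply: eq_bigr => p /(subsetP JQQ) pQ.
  rewrite !fE; first by ring.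
    by rewrite (subsetP CvV) // inE; apply/orP; left; apply/imsetP; exists p.
  by rewrite (subsetP CvV) // inE; apply/orP; right; apply/imsetP; exists p.
set X := \sum_(p in JQ) _ in dJQ *.
have -> : \sum_(i in J) f i + \sum_(i in E0) f i + (\sum_(i in R) f i + (\sum_(p in Q) f p.1 + X * h)) - t = (X - q) * h.
  by rewrite mulrBl -qE /B; ring.
by rewrite dE PoszM dvdz_mul.
Qed.

End FixedSizeSums.

(** * The Erdos-Ginzburg-Ziv theorem *)

Section EGZ.

Definition pairwise_disjoint (I K : finType) (B : K -> {set I}) : Prop :=
  forall k k', k != k' -> [disjoint B k & B k'].

Lemma disjoint_bigcup_ind (I K : finType) (B : K -> {set I}) (P : {set K} -> {set I} -> Prop) :
  pairwise_disjoint B -> P set0 set0 ->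
  (forall (J : {set K}) k, k \notin J -> [disjoint B k & \bigcup_(k' in J) B k'] ->
     P J (\bigcup_(k' in J) B k') -> P (k |: J) (B k :|: \bigcup_(k' in J) B k')) ->
  forall J : {set K}, P J (\bigcup_(k in J) B k).
Proof.
move=> dis P0 PU J; move: {2}#|J| (erefl #|J|) => m; elim: m J => [|m IHm] J cJ.
  by move/eqP: cJ; rewrite cards_eq0 => /eqP ->; rewrite big_set0.
have /set0Pn[k kJ] : J != set0 by rewrite -cards_eq0 cJ.
have cJ' : #|J :\ k| = m by have := cardsD1 k J; rewrite kJ cJ => -[].
rewrite -(setD1K kJ) big_setU1 ?setD11 //; apply: PU (IHm _ cJ'); first by rewrite setD11.
apply: bigcup_disjoint => k'; rewrite !inE => /andP[ne _]; apply: dis.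
by rewrite eq_sym.
Qed.

Lemma sum_disjoint_bigcup (I K : finType) (B : K -> {set I}) (f : I -> int) (J : {set K}) :
  pairwise_disjoint B -> \sum_(i in \bigcup_(k in J) B k) f i = \sum_(k in J) \sum_(i in B k) f i.
Proof.
move=> dis; apply: (@disjoint_bigcup_ind _ _ B (fun J U => \sum_(i in U) f i = \sum_(k in J) \sum_(i in B k) f i)) => //.
  by rewrite !big_set0.
by move=> {}J k kJ dk IH; rewrite big_disjointU // IH big_setU1.
Qed.

Lemma card_disjoint_bigcup (I K : finType) (B : K -> {set I}) (J : {set K}) (b : nat) :
  pairwise_disjoint B -> (forall k, #|B k| = b) -> #|\bigcup_(k in J) B k| = (b * #|J|)%N.
Proof.
move=> dis cB; apply: (@disjoint_bigcup_ind _ _ B (fun J U => #|U| = b * #|J|)%N) => //.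
  by rewrite !cards0 muln0.
by move=> {}J k kJ dk IH; rewrite cards_disjointU // IH cB cardsU1 kJ mulnDr muln1.
Qed.

(** The bound only asks that [m] elements remain when the last of the [j] blocks is removed. *)
Lemma extract_blocks (I : finType) (P : {set I} -> Prop) (m b : nat) :
    (forall U : {set I}, (m <= #|U|)%N -> exists T : {set I}, [/\ T \subset U, #|T| = b & P T]) ->
  forall (j : nat) (U : {set I}), (m + j * b <= #|U| + b)%N ->
  exists B : 'I_j -> {set I}, [/\ pairwise_disjoint B,
    forall k, B k \subset U, forall k, #|B k| = b & forall k, P (B k)].
Proof.
move=> H; elim=> [|j IHj] U le_U.
  by exists (fun _ => set0); split=> [k|k|k|k]; case: (notF (ltn_ord k)).
have [T [TU cT PT]] := H U ltac:(lia).
have /IHj[B [dis BU cB PB]] : (m + j * b <= #|U :\: T| + b)%N.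
  by rewrite cardsD (setIidPr TU) cT; lia.
exists (fun k => oapp B T (unlift ord0 k)).
have dT k : [disjoint T & B k].
  rewrite disjoint_sym; apply: disjointWl (BU k) _; by rewrite disjoints_subset subsetDr.
split=> [k k' ne|k|k|k]; try by case: unliftP => /= *; rewrite ?TU ?(subset_trans (BU _)) ?subsetDl ?cT ?cB.
  move: ne; case: unliftP => [u ->|->]; case: unliftP => [u' ->|->] //= ne.
  - by apply: dis; apply: contraNneq ne => ->.
  - by rewrite disjoint_sym.
Qed.

(* List the elements by increasing residue and pair the [k]-th with the
   [k + p - 1]-st: either [p] consecutive elements agree modulo [p], or the [p - 1]
   differences are all nonzero and their subset sums hit every residue. *)
Lemma egz_prime (I : finType) (f : I -> int) (p : nat) (U : {set I}) : prime p -> (2 * p - 1 <= #|U|)%N ->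
  exists T : {set I}, [/\ T \subset U, #|T| = p & (p %| \sum_(i in T) f i)%Z].
Proof.
move=> pr_p le_U; have p0 := prime_gt0 pr_p; have p1 := prime_gt1 pr_p.
have p0' : (p : int) != 0 by lia.
pose r i := `|(f i %% p)%Z|%N.
have rE i : (p %| f i - (r i)%:Z)%Z.
  by rewrite /r gez0_abs ?modz_ge0 // {1}(divz_eq (f i) p) addrK dvdz_mull.
pose s := sort (fun i j => (r i <= r j)%N) (enum U).
have sz : size s = #|U| by rewrite size_sort cardE.
have us : uniq s by rewrite sort_uniq enum_uniq.
have memU i : i \in s -> i \in U by rewrite mem_sort mem_enum.
have /card_gt0P[i0 _] : (0 < #|U|)%N by lia.
have srt : sorted (fun i j => (r i <= r j)%N) s.
  by apply: sort_sorted => i j; apply: leq_total.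
pose e k := nth i0 s k.
have mono j k : (j <= k < #|U|)%N -> (r (e j) <= r (e k))%N.
  move=> /andP[jk kU]; apply: (@sorted_leq_nth _ (fun i j => (r i <= r j)%N)) => //; rewrite ?inE ?sz //.
  - by move=> a b c; apply: leq_trans.
  - exact: leq_ltn_trans kU.
have inj_e j k : (j < #|U|)%N -> (k < #|U|)%N -> e j = e k -> j = k.
  by move=> jU kU /eqP; rewrite nth_uniq ?sz // => /eqP.
have eU k : (k < #|U|)%N -> e k \in U by move=> kU; apply: memU; rewrite mem_nth ?sz.
have [/existsP[k /eqP ek]|nex] := boolP [exists k : 'I_p, r (e k) == r (e (k + p.-1)%N)].
  exists [set e (k + j)%N | j : 'I_p in [set: 'I_p]]; have kp := ltn_ord k.
  have inj : injective (fun j : 'I_p => e (k + j)%N).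
    move=> j j' /inj_e; have := ltn_ord j; have := ltn_ord j' => ? ? eq_jj'.
    by apply: val_inj => /=; have := eq_jj' ltac:(lia) ltac:(lia); lia.
  split; first by apply/subsetP => _ /imsetP[j _ ->]; apply: eU; have := ltn_ord j; lia.
    by rewrite card_imset // cardsT card_ord.
  rewrite big_imset /=; last by move=> ? ? _ _; apply: inj.
  have -> : \sum_(j in [set: 'I_p]) f (e (k + j)%N) =
     \sum_(j in [set: 'I_p]) (f (e (k + j)%N) - (r (e k))%:Z) + (r (e k))%:Z * p.
    by rewrite sumrB sumr_const cardsT card_ord -mulr_natr natz subrK.
  rewrite rpredD ?dvdz_mull // rpred_sum // => j _; have jp := ltn_ord j.
  have -> : r (e k) = r (e (k + j)%N).
    by apply/eqP; rewrite eqn_leq mono ?ek ?mono //; lia.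
  exact: rE.
pose D (k : 'I_p) := f (e (k + p.-1)%N) - f (e k).
have Dnz k : ~~ (p %| D k)%Z.
  apply: contra nex => pk; apply/existsP; exists k; apply/eqP.
  rewrite /r; congr (absz _); apply/esym/eqP.
  by rewrite eqz_mod_dvd.
have lastlt : (p.-1 < p)%N by lia.
pose last := Ordinal lastlt.
(* Index 0 switches to position p - 1, the original place of [last]. Hence [last] is always
   switched, to 2p - 2, and only the other p - 1 indices are free. *)
pose W := [set~ last].
have cW : #|W| = p.-1 by rewrite cardsC1 card_ord.
case: (subset_sums_dichotomy D W p0) => [[d [dp d1 card_d]]|[F [FW _ hitF]]].
  have dE : d = p by case/primeP: pr_p => _ /(_ d dp); case: eqP => [|_ /eqP//]; lia.
  exfalso; move: card_d; rewrite dE (_ : [set _ in _ | _] = W) ?cW; first lia.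
  by apply/setP => k; rewrite !inE Dnz andbT.
have [J JF hJ] := hitsP _ _ _ _ (hitF (- (\sum_k f (e (k : 'I_p)) + D last))).
have lJ : last \notin J by apply/negP => /(subsetP JF)/(subsetP FW); rewrite !inE eqxx.
pose J' := last |: J.
pose h (k : 'I_p) := (k + (k \in J') * p.-1)%N.
have ltJ (k : 'I_p) : k \notin J' -> (k < p.-1)%N.
  have := ltn_ord k; rewrite /J' !inE negb_or -val_eqE /= => ? /andP[? _]; lia.
have hU k : (h k < #|U|)%N by have := ltn_ord k; rewrite /h; case: (_ \in _) => /=; lia.
have inj_h : injective (fun k => e (h k)).
  move=> k k' /inj_e-/(_ (hU k) (hU k')); have := ltn_ord k; have := ltn_ord k'.
  move: (ltJ k) (ltJ k'); rewrite /h.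
  case: (k \in J'); case: (k' \in J') => /= H1 H2 ? ? ?; apply: val_inj => /=.
  - by lia.
  - by have := H2 isT; lia.
  - by have := H1 isT; lia.
  - by lia.
exists [set e (h k) | k in [set: 'I_p]]; split.
- by apply/subsetP => _ /imsetP[k _ ->]; apply: eU.
- by rewrite card_imset // cardsT card_ord.
rewrite big_imset /=; last by move=> ? ? _ _; apply: inj_h.
have -> : \sum_(k in [set: 'I_p]) f (e (h k)) = \sum_k f (e (k : 'I_p)) + \sum_(k in J') D k.
  rewrite (eq_bigl predT) => [|k]; last by rewrite inE.
  rewrite [X in _ = _ + X]big_mkcond -big_split; apply: eq_bigr => k _ /=.
  by rewrite /h /D; case: (k \in J'); rewrite ?mul1n ?mul0n ?addn0; ring.
rewrite /J' big_setU1 //=.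
move: hJ; set a := \sum_(k in J) _; set b := \sum_k _; rewrite (_ : a - - (b + D last) = b + (D last + a)) //; by ring.
Qed.

(** Multiplicativity: with d = qp, extract 2q - 1 blocks of [p] terms with sum divisible by [p], and
    apply the induction hypothesis to the block sums divided by [p]. *)
Lemma egz (I : finType) (f : I -> int) (d : nat) (U : {set I}) : (0 < d)%N -> (2 * d - 1 <= #|U|)%N ->
  exists T : {set I}, [/\ T \subset U, #|T| = d & (d %| \sum_(i in T) f i)%Z].
Proof.
elim/ltn_ind: d => d IHd in I f U *; move=> d0 le_U.
have [d1|d1] := leqP d 1.
  have d1' : d = 1%N by lia.
  have [T TU cT] := @subset_of_size _ U 1 ltac:(lia).
  by exists T; rewrite TU cT d1' dvd1z.
pose p := pdiv d; have pr_p : prime p by apply: pdiv_prime.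
have p1 := prime_gt1 pr_p.
have dE : d = (d %/ p * p)%N by rewrite divnK // pdiv_dvd.
set q := (d %/ p)%N in dE.
have q0 : (0 < q)%N by nia.
have ltq : (q < d)%N by nia.
pose P (T : {set I}) := (p %| \sum_(i in T) f i)%Z.
have HP (V : {set I}) : (2 * p - 1 <= #|V|)%N -> exists T : {set I}, [/\ T \subset V, #|T| = p & P T].
  by move=> leV; have [T []] := egz_prime f pr_p leV; exists T.
have [|B [dis BU cB PB]] := @extract_blocks _ P _ _ HP (2 * q - 1) U; first by nia.
pose w k := ((\sum_(i in B k) f i)%R %/ p)%Z.
have [|J [_ cJ dJ]] := IHd q ltq _ w setT q0; first by rewrite cardsT card_ord.
exists (\bigcup_(k in J) B k); split.
- by apply/bigcupsP => k _.
- by rewrite (card_disjoint_bigcup _ dis cB) cJ dE mulnC.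
rewrite sum_disjoint_bigcup //.
have -> : \sum_(k in J) \sum_(i in B k) f i = (\sum_(k in J) w k) * p.
  by rewrite mulr_suml; apply: eq_bigr => k _; rewrite divzK //; apply: PB.
by rewrite dE PoszM dvdz_mul.
Qed.

(** Assemble blocks of n/q terms on which (f - g)/q sums to zero modulo n/q; the shift by [g]
    disappears because [n] divides [r]. Concentration in one class reduces the spare terms to n/q -
    1. *)
Lemma egz_coset (I : finType) (f : I -> int) (n q r : nat) (g : int) (U : {set I}) :
    (0 < n)%N -> (q %| n)%N -> (n %| r)%N -> (0 < r)%N ->
    (forall i, i \in U -> (q %| f i - g)%Z) -> (r + n %/ q <= #|U| + 1)%N ->
  exists T : {set I}, [/\ T \subset U, #|T| = r & (n %| \sum_(i in T) f i)%Z].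
Proof.
move=> n0 qn nr r0 fU le_U; have q0 : (0 < q)%N by apply: dvdn_gt0 qn.
set d := (n %/ q)%N in le_U *; have nE : n = (d * q)%N by rewrite divnK.
have d0 : (0 < d)%N by nia.
have [m rE] := dvdnP nr; have m0 : (0 < m)%N by nia.
pose f' i := ((f i - g) %/ q)%Z.
pose P (T : {set I}) := (d %| \sum_(i in T) f' i)%Z.
have HP (V : {set I}) : (2 * d - 1 <= #|V|)%N -> exists T : {set I}, [/\ T \subset V, #|T| = d & P T].
  by move=> leV; have [T []] := egz f' d0 leV; exists T.
have [|B [dis BU cB PB]] := @extract_blocks _ P _ _ HP (m * q) U; first by nia.
have TU : \bigcup_(k in setT) B k \subset U by apply/bigcupsP => k _.
have cT : #|\bigcup_(k in setT) B k| = r.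
  by rewrite (card_disjoint_bigcup _ dis cB) cardsT card_ord rE nE; nia.
exists (\bigcup_(k in setT) B k); split=> //.
have -> : \sum_(i in \bigcup_(k in setT) B k) f i = (\sum_(i in \bigcup_(k in setT) B k) f' i) * q + g * r.
  have -> : g * r = \sum_(i in \bigcup_(k in setT) B k) g by rewrite sumr_const cT -mulr_natr natz.
  rewrite mulr_suml -big_split; apply: eq_bigr => i iT /=.
  by rewrite divzK ?subrK //; apply: fU; apply: (subsetP TU).
rewrite rpredD //; last by rewrite rE PoszM mulrA dvdz_mull.
rewrite {1}nE PoszM dvdz_mul // sum_disjoint_bigcup //; apply: rpred_sum => k _; exact: PB.
Qed.

Lemma pair_up (I : finType) (C : eqType) (cl : I -> C) (U : {set I}) :
  exists (m : nat) (p q : 'I_m -> I) (R : {set I}),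
  [/\ pairwise_disjoint (fun k => [set p k; q k]),
      forall k, [/\ p k \in U, q k \in U, p k != q k & cl (p k) = cl (q k)],
      R \subset U, {in R &, injective cl}
    & (forall k, [disjoint R & [set p k; q k]]) /\ (#|R| + 2 * m = #|U|)%N].
Proof.
pose no (k : 'I_0) : I := False_rect I (notF (ltn_ord k)).
move: {2}#|U| (leqnn #|U|) => N; elim: N U => [|N IHN] U le_U.
  exists 0%N, no, no, set0.
  split=> [[]|[]||i|] //; first exact: sub0set; first by rewrite inE.
  by split=> [[]//|]; rewrite cards0; lia.
have [/existsP[i /existsP[j /and4P[iU jU ne /eqP eq_ij]]]|nex] :=
    boolP [exists i, exists j, [&& i \in U, j \in U, i != j & cl i == cl j]]; last first.
  exists 0%N, no, no, U.
  split=> [[]|[]||i j iU jU eq_ij|] //; last by split=> [[]//|]; lia.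
  apply/eqP; apply: contraNT nex => ne; apply/existsP; exists i; apply/existsP; exists j.
  by rewrite iU jU ne eq_ij eqxx.
have sub2 : [set i; j] \subset U by apply/subsetP => k; rewrite !inE => /orP[]/eqP->.
have cD : (#|U :\: [set i; j]| + 2 = #|U|)%N.
  rewrite cardsD (setIidPr sub2) cards2 ne subnK //.
  by have := subset_leq_card sub2; rewrite cards2 ne.
have [|m [p [q [R [dis pq RU injR [disR cR]]]]]] := IHN (U :\: [set i; j]); first lia.
have dij k : [disjoint [set i; j] & [set p k; q k]].
  have [pU qU _ _] := pq k; rewrite disjoint_sym disjoints_subset.
  apply/subsetP => a; rewrite in_set2 => /orP[]/eqP->; rewrite in_setC; [move: pU|move: qU];
    by rewrite in_setD => /andP[].
exists m.+1, (fun k => oapp p i (unlift ord0 k)), (fun k => oapp q j (unlift ord0 k)), R.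
split=> //.
- move=> k k'; case: unliftP => [u ->|->]; case: unliftP => [u' ->|->] //= neq.
  + by apply: dis; apply: contraNneq neq => ->.
  + by rewrite disjoint_sym.
- move=> k; case: unliftP => [u|] _ //=; have [] := pq u.
  by rewrite !inE => /andP[_ ->] /andP[_ ->].
- exact: subset_trans RU (subsetDl _ _).
split=> [k|]; last lia.
case: unliftP => [u|] _ //=; apply: disjointWl RU _.
by rewrite disjoints_subset subsetDr.
Qed.

End EGZ.

(** * Exponents of products in the metacyclic group *)

Section Realizes.
Variables (I : finType) (c : pred I) (a : I -> int) (n : nat) (s : int).
Implicit Types (T U M J : {set I}) (u v : int).

(* The index [i] stands for the group element [x y^(a i)] if [c i], and for
   [y^(a i)] otherwise.  [realizes T v] gives an ordering of the terms indexed by [T]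
   whose product is [y^v]; the last clause reads
   [x y^(a i) y^u x y^(a j) = y^(n/2 + s (a i + u) + a j)]. *)
Inductive realizes : {set I} -> int -> Prop :=
| Realizes0 : realizes set0 0
| Realizes1 i : ~~ c i -> realizes [set i] (a i)
| RealizesU T1 T2 v1 v2 : [disjoint T1 & T2] -> realizes T1 v1 -> realizes T2 v2 ->
    realizes (T1 :|: T2) (v1 + v2)
| RealizesC M u i j : c i -> c j -> i != j -> i \notin M -> j \notin M -> realizes M u ->
    realizes (i |: (j |: M)) ((n %/ 2)%N%:Z + s * (a i + u) + a j).

Lemma realizes_bigcup (K : finType) (B : K -> {set I}) (v : K -> int) (J : {set K}) :
  pairwise_disjoint B -> (forall k, realizes (B k) (v k)) ->
  realizes (\bigcup_(k in J) B k) (\sum_(k in J) v k).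
Proof.
move=> dis rB.
apply: (@disjoint_bigcup_ind _ _ B (fun (J : {set K}) (U : {set I}) => realizes U (\sum_(k in J) v k))) => //.
  by rewrite big_set0; exact: Realizes0.
by move=> {}J k kJ dk IH; rewrite big_setU1 //; apply: RealizesU.
Qed.

Lemma realizes_setC T : (forall i, i \in T -> ~~ c i) -> realizes T (\sum_(i in T) a i).
Proof.
move: {2}#|T| (erefl #|T|) => m; elim: m T => [|m IHm] T cT TC.
  by move/eqP: cT; rewrite cards_eq0 => /eqP ->; rewrite big_set0; exact: Realizes0.
have /set0Pn[i iT] : T != set0 by rewrite -cards_eq0 cT.
rewrite -(setD1K iT) big_setU1 ?setD11 //=; apply: RealizesU.
- by rewrite disjoints1 setD11.
- by apply: Realizes1; apply: TC.
- apply: IHm => [|j]; first by have := cardsD1 i T; rewrite iT cT => -[].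
  by rewrite inE => /andP[_]; apply: TC.
Qed.

Lemma realizes_pair i j : c i -> c j -> i != j ->
  realizes [set i; j] ((n %/ 2)%N%:Z + s * a i + a j).
Proof.
move=> ci cj ne; have := RealizesC ci cj ne _ _ Realizes0.
by rewrite !inE setU0 addr0; apply.
Qed.

(** The form in which flips are used: [M] goes between two terms of x<y> and has its exponent
    multiplied by [s], while [O] stays outside. *)
Lemma realizes_sandwich M O u v i j : c i -> c j -> i != j -> realizes M u -> realizes O v ->
  [disjoint M & O] -> i \notin M :|: O -> j \notin M :|: O ->
  realizes (i |: (j |: (M :|: O))) ((n %/ 2)%N%:Z + s * (a i + u) + a j + v).
Proof.
move=> ci cj ne rM rO dis; rewrite !inE !negb_or => /andP[iM iO] /andP[jM jO].
have -> : i |: (j |: (M :|: O)) = (i |: (j |: M)) :|: O by rewrite !setUA.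
apply: RealizesU rO; last exact: RealizesC.
apply/pred0P => k /=; rewrite !in_setU1.
have [->|_] := eqVneq k i; first by rewrite (negPf iO).
have [->|_] := eqVneq k j; first by rewrite (negPf jO).
by move/pred0P: dis => /(_ k).
Qed.

(** Modulo a divisor of s - 1 the order of the terms does not matter, so any pairing gives the same
    exponent. *)
Lemma realizes_even_coset T : (forall i, i \in T -> c i) -> ~~ odd #|T| ->
  exists2 v, realizes T v & forall e : nat, (e %| s - 1)%Z ->
    (e %| v - ((n %/ 2)%N%:Z *+ #|T|./2 + \sum_(i in T) a i))%Z.
Proof.
move=> TC oddT; have [m [p [q [R [dis pq RT injR [disR cR]]]]]] := pair_up (fun _ => tt) T.
have cR1 : (#|R| <= 1)%N.
  by rewrite leqNgt; apply/negP => /card_gt1P[i [j [iR jR]]]; rewrite (injR i j) ?eqxx.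
have R0 : #|R| = 0%N by move: oddT; rewrite -cR oddD mul2n odd_double addbF; case: #|R| cR1 => [|[]].
have cB k : #|[set p k; q k]| = 2%N by have [_ _ ne _] := pq k; rewrite cards2 ne.
have TE : \bigcup_(k in setT) [set p k; q k] = T.
  apply/eqP; rewrite eqEcard (card_disjoint_bigcup _ dis cB) cardsT card_ord -cR R0 leqnn andbT.
  by apply/bigcupsP => k _; have [pT qT _ _] := pq k; apply/subsetP => i; rewrite !inE => /orP[]/eqP->.
exists (\sum_(k in setT) ((n %/ 2)%N%:Z + s * a (p k) + a (q k))).
  rewrite -[X in realizes X _]TE; apply: realizes_bigcup => // k.
  by have [pT qT ne _] := pq k; apply: realizes_pair => //; apply: TC.
move=> e es; rewrite -[in X in (_ %| _ - (_ + X))%Z]TE sum_disjoint_bigcup //.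
have -> : #|T|./2 = #|[set: 'I_m]| by rewrite -cR R0 add0n mul2n doubleK cardsT card_ord.
rewrite -sumr_const -big_split -sumrB; apply: rpred_sum => k _ /=.
have [_ _ ne _] := pq k; rewrite big_setU1 ?inE //= big_set1.
have -> : (n %/ 2)%N%:Z + s * a (p k) + a (q k) - ((n %/ 2)%N%:Z + (a (p k) + a (q k))) = (s - 1) * a (p k) by ring.
exact: dvdz_mulr.
Qed.

End Realizes.

(** * From realised exponents to products in the group *)

Section Soundness.
Variables (gT : finGroupType) (x y : gT) (n : nat) (s : int).
Hypotheses (n0 : (0 < n)%N) (x2 : (x ^+ 2 = y ^+ (n %/ 2)%N)%g) (yn : (y ^+ n = 1)%g)
  (yx : (y * x = x * y ^+ (absz (s %% n%:Z)%Z))%g).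

(** Reduction modulo [n] gives [y] an integer exponent while using only natural powers. *)
Definition zpow (v : int) : gT := (y ^+ `|(v %% n)%Z|%N)%g.

Lemma zpow_nat (k : nat) : zpow k = (y ^+ k)%g.
Proof. by rewrite /zpow modz_nat /= (expg_mod _ yn). Qed.

Lemma zpow_eqmod u v : (n %| u - v)%Z -> zpow u = zpow v.
Proof. by rewrite -eqz_mod_dvd => /eqP uv; rewrite /zpow uv. Qed.

Lemma zpow_repr v : exists k : nat, zpow v = (y ^+ k)%g /\ (n %| k%:Z - v)%Z.
Proof.
have n0' : (n : int) != 0 by lia.
exists `|(v %% n)%Z|%N; split=> //; rewrite gez0_abs ?modz_ge0 //.
by rewrite -eqz_mod_dvd modz_mod.
Qed.

Lemma zpowD u v : zpow (u + v) = (zpow u * zpow v)%g.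
Proof.
have [k [-> ku]] := zpow_repr u; have [l [-> lv]] := zpow_repr v.
rewrite -expgD -zpow_nat; apply/esym/zpow_eqmod.
have -> : (k + l)%N%:Z - (u + v) = (k%:Z - u) + (l%:Z - v) by rewrite PoszD; ring.
exact: rpredD.
Qed.

Lemma zpow_x u : (zpow u * x)%g = (x * zpow (s * u))%g.
Proof.
have [k [-> ku]] := zpow_repr u; have [s' [zs s's]] := zpow_repr s.
have yx' : (y * x = x * y ^+ s')%g by rewrite yx -zs.
have E : (y ^+ k * x = x * y ^+ (s' * k))%g.
  elim: k {ku} => [|k IHk]; first by rewrite muln0 !expg0 mul1g mulg1.
  by rewrite expgSr -mulgA yx' mulgA IHk -mulgA -expgD mulnS addnC.
rewrite E -zpow_nat; congr (_ * _)%g; apply: zpow_eqmod.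
have -> : (s' * k)%N%:Z - s * u = (s'%:Z - s) * k + s * (k%:Z - u) by rewrite PoszM; ring.
by apply: rpredD; [apply: dvdz_mulr|apply: dvdz_mull].
Qed.

Variables (I : finType) (c : pred I) (a : I -> int).
Definition term (i : I) : gT := (x ^+ (c i) * zpow (a i))%g.

Lemma realizes_prod T v : realizes c a n s T v ->
  exists t : seq I, [/\ uniq t, t =i T & (\prod_(i <- t) term i)%g = zpow v].
Proof.
elim=> {T v} [|i ci|T1 T2 v1 v2 dis _ [t1 [u1 e1 p1]] _ [t2 [u2 e2 p2]]|M u i j ci cj ne iM jM _ [t [ut et pt]]].
- exists [::]; split=> [//|i|]; first by rewrite inE.
  by rewrite big_nil (zpow_nat 0) expg0.
- exists [:: i]; split=> [//|j|]; first by rewrite !inE.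
  by rewrite big_seq1 /term (negPf ci) expg0 mul1g.
- exists (t1 ++ t2); split=> [|i|].
  + rewrite cat_uniq u1 u2 andbT /=; apply/hasPn => i; rewrite e2 => i2; rewrite e1.
    by apply/negP => i1; move/pred0P: dis => /(_ i) /=; rewrite i1 i2.
  + by rewrite mem_cat e1 e2 inE.
  + by rewrite big_cat /= p1 p2 zpowD.
- exists (i :: rcons t j); split=> [|k|].
  + by rewrite /= rcons_uniq mem_rcons inE negb_or ne !et iM jM.
  + by rewrite inE mem_rcons !inE et.
  + rewrite big_cons -cats1 big_cat big_seq1 pt /term ci cj expg1 /=.
    have -> : (x * zpow (a i) * (zpow u * (x * zpow (a j))) = x * ((zpow (a i) * zpow u) * x) * zpow (a j))%g.
      by rewrite !mulgA.
    by rewrite -zpowD zpow_x mulgA -expg2 x2 -zpow_nat -!zpowD.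
Qed.

End Soundness.

(** * The case n = 0 modulo 4 *)

Section FourDivides.

Lemma superset_of_size (I : finType) (A B : {set I}) (m : nat) :
  A \subset B -> (#|A| <= m <= #|B|)%N -> exists D : {set I}, [/\ A \subset D, D \subset B & #|D| = m].
Proof.
move=> AB /andP[Am mB]; have cBA : #|B :\: A| = (#|B| - #|A|)%N by rewrite cardsD (setIidPr AB).
have [D DB cD] := @subset_of_size _ (B :\: A) (m - #|A|) ltac:(lia).
exists (A :|: D); split; first exact: subsetUl.
  by rewrite subUset AB (subset_trans DB) ?subsetDl.
rewrite cards_disjointU ?cD ?subnKC //.
by rewrite disjoint_sym; apply: disjointWl DB _; rewrite disjoints_subset subsetDr.
Qed.

Lemma dvdz_parity u v : ((2 %| u)%Z == (2 %| v)%Z) -> (2 %| u + v)%Z.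
Proof. lia. Qed.

Variables (I : finType) (c : pred I) (a : I -> int) (n : nat) (s : int).
Implicit Types (T U M J : {set I}) (u v : int).
Local Notation realizes := (realizes c a n s).
Local Notation n2 := ((n %/ 2)%N%:Z).

Definition realizes_multiple (e : nat) T : Prop := exists2 v, realizes T v & (e %| v)%Z.

(** With n = km, the 2n terms yield 2k - 1 blocks of length [m], the last one from exactly 2m
    remaining terms; Erdos-Ginzburg-Ziv then selects [k] of them. *)
Lemma lift_divisor (m : nat) : (0 < n)%N -> (m %| n)%N ->
  (forall U, (2 * m <= #|U|)%N -> exists T, [/\ T \subset U, #|T| = m & realizes_multiple m T]) ->
  forall U, (2 * n <= #|U|)%N -> exists T, [/\ T \subset U, #|T| = n & realizes_multiple n T].
Proof.
move=> n0 mn H U le_U; have m0 : (0 < m)%N by apply: dvdn_gt0 mn.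
set k := (n %/ m)%N; have nE : n = (k * m)%N by rewrite divnK.
have k0 : (0 < k)%N by nia.
have [|B [dis BU cB PB]] := @extract_blocks _ (realizes_multiple m) _ _ H (2 * k - 1) U; first by nia.
have [v rv] := fin_all_exists2 PB => vm.
have [|J [_ cJ dJ]] := egz (fun i => (v i %/ m)%Z) (U := setT) k0; first by rewrite cardsT card_ord.
exists (\bigcup_(i in J) B i); split; first by apply/bigcupsP.
  by rewrite (card_disjoint_bigcup _ dis cB) cJ nE mulnC.
exists (\sum_(i in J) v i); first exact: realizes_bigcup.
have -> : \sum_(i in J) v i = (\sum_(i in J) (v i %/ m)%Z) * m.
  by rewrite mulr_suml; apply: eq_bigr => i _; rewrite divzK.
by rewrite nE PoszM dvdz_mul.
Qed.

Definition pair_value (i j : I) : int := if c i then n2 + s * a i + a j else a i + a j.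

Lemma realizes_pair_value i j : i != j -> c i = c j -> realizes [set i; j] (pair_value i j).
Proof.
move=> ne eq_c; rewrite /pair_value; case: (boolP (c i)) => ci.
  by apply: realizes_pair; rewrite -?eq_c.
have := @realizes_setC _ c a n s [set i; j]; rewrite big_setU1 ?inE //= big_set1; apply.
by move=> k; rewrite !inE => /orP[]/eqP->; rewrite -?eq_c.
Qed.

Lemma pair_value_even i j : (2 %| n2)%Z -> (2 %| s - 1)%Z ->
  (2 %| a i)%Z = (2 %| a j)%Z -> (2 %| pair_value i j)%Z.
Proof.
move=> n2_2 s_2 par; have aa : (2 %| a i + a j)%Z by apply: dvdz_parity; apply/eqP.
rewrite /pair_value; case: ifP => // _.
have -> : n2 + s * a i + a j = n2 + (s - 1) * a i + (a i + a j) by ring.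
by dvz.
Qed.

Lemma card_injective_bool2 (R : {set I}) (cl : I -> bool * bool) : {in R &, injective cl} -> (#|R| <= 4)%N.
Proof.
by move=> inj; rewrite -(card_in_imset inj); apply: leq_trans (max_card _) _; rewrite card_prod card_bool.
Qed.

(* The base case [m = 2p] of [lift_divisor]. The terms are paired by coset and by
   the parity of the exponent. Placing a pair inside a fixed pair of terms
   of [xN] negates its value modulo [p], so that [p - 1] pairs of nonzero value
   produce every residue modulo [p]. *)
Lemma odd_prime_base (p : nat) U : prime p -> odd p -> (p %| s + 1)%Z -> (2 %| s - 1)%Z ->
    (2 * p %| n2)%Z -> (4 * p <= #|U|)%N ->
  exists T, [/\ T \subset U, #|T| = (2 * p)%N & realizes_multiple (2 * p) T].
Proof.
move=> pr_p odd_p sp s2 n2_2p le_U; have p0 := prime_gt0 pr_p; have p1 := prime_gt1 pr_p.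
have p3 : (3 <= p)%N by move: p1 odd_p; case: (p) => [|[|[|]]].
have n2_p : (p %| n2)%Z by apply: dvdz_trans n2_2p; rewrite PoszM dvdz_mull.
have n2_2 : (2 %| n2)%Z by apply: dvdz_trans n2_2p; rewrite PoszM dvdz_mulr.
have dvd2p v : (2 %| v)%Z -> (p %| v)%Z -> ((2 * p)%N %| v)%Z.
  move=> v2 vp; rewrite PoszM Gauss_dvdz ?v2 ?vp // coprimezE.
  exact: (etrans (coprime2n p) odd_p).
have flip_p u : (p %| (s - 1) * u)%Z = (p %| u)%Z.
  have -> : (p %| (s - 1) * u)%Z = (p %| 2 * u)%Z.
    apply/idP/idP => H.
      have -> : 2 * u = (s + 1) * u - (s - 1) * u by ring.
      dvz.
    have -> : (s - 1) * u = (s + 1) * u - 2 * u by ring.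
      dvz.
  by rewrite Gauss_dvdzr // coprimezE; apply: (etrans (coprimen2 p) odd_p).
(* Flipping [w k] adds (s - 1) * w k, which is nonzero modulo [p]; p - 1 such flips cannot be
   concentrated in a proper subgroup of the prime cyclic group. *)
have fill (K : finType) (w : K -> int) (F0 : {set K}) : (p.-1 <= #|F0|)%N -> (forall k, k \in F0 -> ~~ (p %| w k)%Z) ->
    exists2 F : {set K}, F \subset F0 /\ (#|F| < p)%N & forall t, hits p (fun k => (s - 1) * w k) F t.
  move=> cF0 nz; case: (subset_sums_dichotomy (fun k => (s - 1) * w k) F0 p0) => [[d [dp d1 card_d]]|[F [? ? ?]]]; last by exists F.
  have dE : d = p by case/primeP: pr_p => _ /(_ d dp); case: eqP => [|_ /eqP//]; lia.
  exfalso; move: card_d; rewrite dE (_ : [set _ in _ | _] = F0); first lia.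
  by apply/setP => k; rewrite !inE flip_p; case: (boolP (k \in F0)) => //= /nz.
pose C := [set i in U | c i]; pose N := [set i in U | ~~ c i].
have cCN : (#|C| + #|N| = #|U|)%N.
  rewrite -(cardsID [set i | c i] U); congr (_ + _)%N; apply: eq_card => i; rewrite !inE //.
  by rewrite andbC.
have NU : N \subset U by apply/subsetP => i; rewrite inE => /andP[].
have Nc i : i \in N -> ~~ c i by rewrite inE => /andP[].
have N_only T : T \subset N -> #|T| = (2 * p)%N -> ((2 * p)%N %| \sum_(i in T) a i)%Z ->
  exists T, [/\ T \subset U, #|T| = (2 * p)%N & realizes_multiple (2 * p) T].
  move=> TN cT dT; exists T; split=> //; first exact: subset_trans TN NU.
  by exists (\sum_(i in T) a i) => //; apply: realizes_setC => i /(subsetP TN)/Nc.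
have [/existsP[i /existsP[j /and4P[iC jC ne /eqP par]]]|nopair] :=
  boolP [exists i, exists j, [&& i \in C, j \in C, i != j & (2 %| a i)%Z == (2 %| a j)%Z]].
- have [[iU ci] [jU cj]] : (i \in U /\ c i) /\ (j \in U /\ c j).
    by move: iC jC; rewrite !inE => /andP[? ?] /andP[? ?].
  have [m [f1 [f2 [R [dis fU RU injR [disR cR]]]]]] := pair_up (fun i => (c i, (2 %| a i)%Z)) (U :\: [set i; j]).
  have cU' : (#|U :\: [set i; j]| + 2 = #|U|)%N.
    have sub2 : [set i; j] \subset U by apply/subsetP => k; rewrite !inE => /orP[]/eqP->.
    rewrite cardsD (setIidPr sub2) cards2 ne subnK //.
    by have := subset_leq_card sub2; rewrite cards2 ne.
  have cR4 := card_injective_bool2 injR.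
  (* The index [None] stands for the special pair [i], [j] between which flipped pairs are
     placed. *)
  pose g1 k := oapp f1 i k; pose g2 k := oapp f2 j k.
  pose B k := [set g1 k; g2 k]; pose w k := pair_value (g1 k) (g2 k).
  have gP k : [/\ g1 k \in U, g2 k \in U, g1 k != g2 k, c (g1 k) = c (g2 k) & (2 %| a (g1 k))%Z = (2 %| a (g2 k))%Z].
    case: k => [k|] /=; last by rewrite ci cj.
    have [] := fU k; rewrite !inE => /andP[_ ->] /andP[_ ->] -> [-> ->] //.
  have cB k : #|B k| = 2%N by have [_ _ neq _ _] := gP k; rewrite cards2 neq.
  have BU k : B k \subset U by have [? ? _ _ _] := gP k; apply/subsetP => l; rewrite !inE => /orP[]/eqP->.
  have rB k : realizes (B k) (w k) by have [_ _ ? ? _] := gP k; apply: realizes_pair_value.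
  have w2 k : (2 %| w k)%Z by have [_ _ _ _ ?] := gP k; apply: pair_value_even.
  have notB k l : (l == i) || (l == j) -> l \notin [set f1 k; f2 k].
    move=> lij; have [] := fU k; rewrite !inE => /andP[p1' _] /andP[p2' _] _ _.
    by apply/negP => /orP[]/eqP le; move: p1' p2'; rewrite -le lij.
  have disB : pairwise_disjoint B.
    move=> [k|] [k'|] //= neq; first by apply: dis; apply: contraNneq neq => ->.
      rewrite disjoint_sym disjoints_subset; apply/subsetP => l; rewrite !inE => lij.
      by have := notB k l lij; rewrite !inE.
    rewrite disjoints_subset; apply/subsetP => l; rewrite !inE => lij.
    by have := notB k' l lij; rewrite !inE.
  have cK : (2 * p - 2 <= #|{: option 'I_m}|)%N by rewrite card_option card_ord; move: cR cR4 cU' le_U; clear; lia.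
  pose Z := [set k | (p %| w k)%Z].
  have [Zp|Zp] := leqP p #|Z|.
    have [J JZ cJ] := subset_of_size Zp.
    exists (\bigcup_(k in J) B k); split; first by apply/bigcupsP.
      by rewrite (card_disjoint_bigcup _ disB cB) cJ.
    exists (\sum_(k in J) w k); first exact: realizes_bigcup.
    apply: dvd2p; apply: rpred_sum => // k /(subsetP JZ); by rewrite inE.
  have cZC : (p.-1 <= #|~: Z|)%N by have := cardsC Z; move: cK Zp p0; rewrite card_option card_ord; clear; lia.
  have [F0 F0Z cF0] := subset_of_size cZC.
  have nzF0 k : k \in F0 -> ~~ (p %| w k)%Z by move=> /(subsetP F0Z); rewrite !inE.
  have [|F [FF0 _] hitF] := fill _ w F0 _ nzF0; first by rewrite cF0.
  have [||K0 [subK0 _ cK0]] := @superset_of_size _ (None |: F0) setT p; first exact: subsetT.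
    rewrite cardsU1 cF0 cardsT; move: cK p0; rewrite card_option card_ord.
    by case: (_ \notin _) => /=; clear; lia.
  have NK0 : None \in K0 by rewrite (subsetP subK0) // !inE eqxx.
  have [J JF hJ] := hitsP _ _ _ _ (hitF (- \sum_(k in K0) w k)).
  have JK0 : J \subset K0 by apply: subset_trans JF (subset_trans FF0 (subset_trans _ subK0)); apply: subsetUr.
  pose M := \bigcup_(k in J :\ None) B k; pose O := \bigcup_(k in (K0 :\: J) :\ None) B k.
  have rM : realizes M (\sum_(k in J :\ None) w k) by apply: realizes_bigcup.
  have rO : realizes O (\sum_(k in (K0 :\: J) :\ None) w k) by apply: realizes_bigcup.
  have MO : M :|: O = \bigcup_(k in K0 :\ None) B k.
    rewrite /M /O -bigcup_setU; apply: eq_bigl => k; rewrite !inE.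
    by case: (boolP (k \in J)) => [/(subsetP JK0) ->|_]; case: (k != None).
  have disMO : [disjoint M & O].
    apply: bigcup_disjoint => k; rewrite !inE => /and3P[_ kJ _]; rewrite disjoint_sym.
    apply: bigcup_disjoint => k'; rewrite !inE => /andP[_ k'J]; apply: disB.
    by apply: contraNneq kJ => ->.
  have TE : i |: (j |: (M :|: O)) = \bigcup_(k in K0) B k.
    by rewrite MO -[in RHS](setD1K NK0) big_setU1 ?setD11 //= setUA.
  have notMO l : (l == i) || (l == j) -> l \notin M :|: O.
    move=> lij; rewrite MO; apply/negP => /bigcupP[[k|]]; rewrite !inE // => _.
    by have := notB k l lij; rewrite !inE => /negP.
  have iMO : i \notin M :|: O by apply: notMO; rewrite eqxx.
  have jMO : j \notin M :|: O by apply: notMO; rewrite eqxx orbT.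
  exists (\bigcup_(k in K0) B k); split; first by apply/bigcupsP.
    by rewrite (card_disjoint_bigcup _ disB cB) cK0.
  have sumK0 : \sum_(k in K0) w k = \sum_(k in J) w k + \sum_(k in K0 :\: J) w k.
    by rewrite (big_setID J) /= (setIidPr JK0).
  move: hJ; rewrite opprK -mulr_sumr => hJ.
  have even_sum (A : {set option 'I_m}) : (2 %| \sum_(k in A) w k)%Z by apply: rpred_sum.
  rewrite -TE; have w0E : w None = n2 + s * a i + a j by rewrite /w /pair_value /= ci.
  (* If the special pair itself is to be flipped, exchange [i] and [j]: modulo [p] one has n/2 = 0
     and s^2 = 1, so its value is multiplied by [s]. *)
  have [NJ|NJ] := boolP (None \in J).
    have eO : (K0 :\: J) :\ None = K0 :\: J.
      by apply/setP => k; rewrite !inE; case: eqP => //= ->; rewrite NJ.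
    rewrite (_ : i |: _ = j |: (i |: (M :|: O))); last by rewrite !setUA (setUC [set i]).
    exists (n2 + s * (a j + \sum_(k in J :\ None) w k) + a i + \sum_(k in K0 :\: J) w k).
      by rewrite -[in X in realizes _ X]eO; apply: realizes_sandwich; rewrite // eq_sym.
    apply: dvd2p.
      have -> : n2 + s * (a j + \sum_(k in J :\ None) w k) + a i + \sum_(k in K0 :\: J) w k
        = n2 + (s - 1) * a j + (a i + a j) + s * (\sum_(k in J :\ None) w k) + \sum_(k in K0 :\: J) w k by ring.
      have aij : (2 %| a i + a j)%Z by apply: dvdz_parity; apply/eqP.
      have eJ1 := even_sum (J :\ None); have eKJ := even_sum (K0 :\: J).
      by dvz.
    move: hJ; rewrite sumK0.
    have -> : \sum_(k in J) w k = w None + \sum_(k in J :\ None) w k.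
      by rewrite -{1}(setD1K NJ) big_setU1 ?setD11.
    rewrite w0E => hJ; set X := (X in (_ %| X)%Z).
    have -> : X = ((s - 1) * (n2 + s * a i + a j + \sum_(k in J :\ None) w k) +
          (n2 + s * a i + a j + \sum_(k in J :\ None) w k + \sum_(k in K0 :\: J) w k))
          + n2 * (1 - s) - (s + 1) * ((s - 1) * a i) by rewrite /X; ring.
    by dvz.
  have eJ : J :\ None = J.
    by apply/setP => k; rewrite !inE; case: eqP => //= ->; rewrite (negPf NJ).
  exists (n2 + s * (a i + \sum_(k in J) w k) + a j + \sum_(k in (K0 :\: J) :\ None) w k).
    by rewrite -[in X in realizes _ (_ + X + _ + _)]eJ; apply: realizes_sandwich.
  have eO : \sum_(k in K0 :\: J) w k = w None + \sum_(k in (K0 :\: J) :\ None) w k.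
    by rewrite -{1}(@setD1K _ None (K0 :\: J)) ?big_setU1 ?setD11 // inE NJ NK0.
  set X := (X in ((2 * p)%N %| X)%Z).
  have -> : X = (s - 1) * (\sum_(k in J) w k) + \sum_(k in K0) w k.
    by rewrite /X sumK0 eO w0E; ring.
  have eJ2 := even_sum J; have eK := even_sum K0; apply: dvd2p; by dvz.
have cC2 : (#|C| <= 2)%N.
  have inj : {in C &, injective (fun i => (2 %| a i)%Z)}.
    move=> i j iC jC eq_ij; apply/eqP; apply: contraNT nopair => ne.
    by apply/existsP; exists i; apply/existsP; exists j; rewrite iC jC ne eq_ij eqxx.
  by rewrite -(card_in_imset inj); apply: leq_trans (max_card _) _; rewrite card_bool.
have p20 : (0 < 2 * p)%N by rewrite muln_gt0.
have [cC1|cC1] := leqP #|C| 1.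
  have [|||T [TN cT dT]] := @egz_coset _ a (2 * p) 1 (2 * p) 0 N p20 _ (dvdnn _) p20.
  - by [].
  - by move=> i _; rewrite dvd1z.
  - by rewrite divn1; move: cCN cC1 le_U; clear; lia.
  exact: N_only TN cT dT.
have cC : #|C| == 2%N by rewrite eqn_leq cC2.
have /cards2P[i [j [ne CE]]] := cC.
have [[iU ci] [jU cj]] : (i \in U /\ c i) /\ (j \in U /\ c j).
  have : i \in C by rewrite CE !inE eqxx.
  have : j \in C by rewrite CE !inE eqxx orbT.
  by rewrite !inE => /andP[? ?] /andP[? ?].
(* The two terms of x<y> have exponents of different parity. Now single terms of [N] are flipped
   between them, provided p - 1 of them are nonzero modulo [p]. *)
pose W := [set i in N | ~~ (p %| a i)%Z].
have [cW|cW] := leqP p.-1 #|W|; last first.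
  have cNW : (#|N :\: W| = #|N| - #|W|)%N.
    by rewrite cardsD (setIidPr _) //; apply/subsetP => k; rewrite inE => /andP[].
  have [||T [TN cT dT]] := @egz_coset _ a (2 * p) p (2 * p) 0 (N :\: W) p20 (dvdn_mull _ (dvdnn _)) (dvdnn _) p20.
  - by move=> k; rewrite !inE subr0 => /andP[nW kN]; move: nW; rewrite kN /= negbK.
  - by rewrite mulnK // cNW; move: cCN cC2 cW le_U p3; clear; lia.
  apply: N_only cT dT; exact: subset_trans TN (subsetDl _ _).
have [|F [FW ltF] hitF] := fill _ a W cW; first by move=> k; rewrite inE => /andP[].
have FN : F \subset N by apply: subset_trans FW _; apply/subsetP => k; rewrite inE => /andP[].
have cV : #|N :\: F| = (#|N| - #|F|)%N by rewrite cardsD (setIidPr FN).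
(* The flips handle [p]; the remaining terms only have to correct the parity, which fails only if
   all their exponents have the same parity. *)
have [|||hitV|[e [g [e2 e1 card_e]]]] :=
  @fixed_size_sums_dichotomy _ (N :\: F) 2 (2 * p - 2 - #|F|) a isT; try (rewrite ?cV; move: cCN cC2 ltF le_U p3; clear; lia).
  have [T0 [T0V cT0 dT0]] := hitV (- (n2 + s * a i + a j + \sum_(k in F) a k)).
  have [J JF hJ] := hitsP _ _ _ _ (hitF (- (n2 + s * a i + a j + \sum_(k in F) a k + \sum_(k in T0) a k))).
  have disFT : [disjoint F & T0].
    by rewrite disjoint_sym; apply: disjointWl T0V _; rewrite disjoints_subset subsetDr.
  have T0N : T0 \subset N by apply: subset_trans T0V (subsetDl _ _).
  pose O := (F :\: J) :|: T0.
  have disFJ : [disjoint F :\: J & T0] by apply: disjointWl disFT; apply: subsetDl.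
  have FJO : J :|: O = F :|: T0.
    by rewrite /O setUA -[F in RHS](setID F J) (setIidPr JF).
  have disJO : [disjoint J & O].
    rewrite disjoint_sym disjoints_subset subUset subsetDr /= -disjoints_subset disjoint_sym.
    exact: disjointWl JF disFT.
  have FTN : F :|: T0 \subset N by rewrite subUset FN.
  have iN k : c k -> k \notin J :|: O.
    by rewrite FJO => ck; apply/negP => /(subsetP FTN)/Nc; rewrite ck.
  exists (i |: (j |: (J :|: O))); split.
  - by rewrite subUset sub1set iU subUset sub1set jU FJO (subset_trans FTN).
  - have iJO : i \notin j |: (J :|: O) by rewrite in_setU1 negb_or ne iN.
    rewrite cardsU1 iJO cardsU1 (iN j cj) FJO cards_disjointU // cT0 /=.
    by move: (subset_leq_card FN) cCN cC2 ltF le_U p3; clear; lia.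
  exists (n2 + s * (a i + \sum_(k in J) a k) + a j + (\sum_(k in F :\: J) a k + \sum_(k in T0) a k)).
    apply: realizes_sandwich => //; try exact: iN.
      apply: realizes_setC => k /(subsetP JF)/(subsetP FN); exact: Nc.
    apply: RealizesU => //; apply: realizes_setC => k; last by move/(subsetP T0N)/Nc.
    by rewrite inE => /andP[_ /(subsetP FN)/Nc].
  have sumF : \sum_(k in F) a k = \sum_(k in J) a k + \sum_(k in F :\: J) a k.
    by rewrite (big_setID J) /= (setIidPr JF).
  set X := (X in ((2 * p)%N %| X)%Z).
  have XE : X = (s - 1) * (\sum_(k in J) a k) + (n2 + s * a i + a j + \sum_(k in F) a k + \sum_(k in T0) a k).
    by rewrite /X sumF; ring.
  rewrite XE; apply: dvd2p; last by move: hJ; rewrite opprK -mulr_sumr.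
  by move: dT0; rewrite opprK addrC => dT0; dvz.
have eE : e = 2%N by apply/eqP; rewrite eqn_leq e1 (dvdn_leq _ e2).
have [||T [TN cT dT]] := @egz_coset _ a (2 * p) 2 (2 * p) g (N :\: F) p20 (dvdn_mulr _ (dvdnn _)) (dvdnn _) p20.
- move=> k kV; move: card_e; rewrite eE -[X in (_ <= X)%N](add0n 2) leq_add2r leqn0 cards_eq0 => /eqP/setP/(_ k).
  by rewrite in_set0 inE kV /= => /negbT; rewrite negbK.
- by rewrite mulKn // cV; move: cCN cC2 ltF le_U p3; clear; lia.
apply: N_only cT dT; exact: subset_trans TN (subsetDl _ _).
Qed.

End FourDivides.

(** * The quotient of 2-power order and the conclusion for 4 dividing n *)

Section FourDividesMain.
Lemma Posz2 (b : nat) : (2 * b)%N%:Z = 2 * b%:Z. Proof. lia. Qed.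
Lemma Posz4 (b : nat) : (4 * b)%N%:Z = 4 * b%:Z. Proof. lia. Qed.

Variables (I : finType) (c : pred I) (a : I -> int) (n : nat) (s : int).
Implicit Types (T U M J : {set I}) (u v : int).
Local Notation realizes := (realizes c a n s).
Local Notation n2 := ((n %/ 2)%N%:Z).
Local Notation realizes_multiple := (realizes_multiple c a n s).
Local Notation pair_value := (pair_value c a n s).

(* The base case [m = 4b] of [lift_divisor]. Pair the terms by coset and by
   the parity of the exponent. If one term of each of the four kinds is left over,
   these four terms have a product whose exponent can be shifted by [2b]. *)
Lemma two_power_base (b : nat) U : (0 < b)%N -> ((4 * b)%N %| s - 1 - (2 * b)%N%:Z)%Z ->
    (2 %| n2)%Z -> (2 * (4 * b) <= #|U|)%N ->
  exists T, [/\ T \subset U, #|T| = (4 * b)%N & realizes_multiple (4 * b) T].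
Proof.
move=> b0 sb n2_2 le_U0; have [U' U'U cU'] := subset_of_size le_U0.
suff [T [TU' cT rT]] : exists T, [/\ T \subset U', #|T| = (4 * b)%N & realizes_multiple (4 * b) T].
  by exists T; split=> //; apply: subset_trans U'U.
move: {U U'U le_U0}U' cU' => U cU.
have s2 : (2 %| s - 1)%Z.
  have [z zE] := dvdzP sb; have -> : s - 1 = 2 * (z * (2 * b)%N%:Z + b%:Z) by lia.
  exact: dvdz_mulr.
have [m [f1 [f2 [R [dis fU RU injR [disR cR]]]]]] := pair_up (fun i => (c i, (2 %| a i)%Z)) U.
have cR4 := card_injective_bool2 injR.
pose B k := [set f1 k; f2 k]; pose w k := pair_value (f1 k) (f2 k).
have cB k : #|B k| = 2%N by have [_ _ neq _] := fU k; rewrite cards2 neq.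
have BU k : B k \subset U by have [? ? _ _] := fU k; apply/subsetP => l; rewrite !inE => /orP[]/eqP->.
have rB k : realizes (B k) (w k) by have [_ _ ? [? _]] := fU k; apply: realizes_pair_value.
have w2 k : (2 %| w k)%Z by have [_ _ _ [_ ?]] := fU k; apply: pair_value_even.
pose h k := (w k %/ 2)%Z.
have wE (J : {set 'I_m}) : \sum_(k in J) w k = 2 * \sum_(k in J) h k.
  by rewrite mulr_sumr; apply: eq_bigr => k _; rewrite mulrC divzK.
have b20 : (0 < 2 * b)%N by rewrite muln_gt0.
have pairs_only (J : {set 'I_m}) : #|J| = (2 * b)%N -> ((2 * b)%N %| \sum_(k in J) h k)%Z ->
    exists T, [/\ T \subset U, #|T| = (4 * b)%N & realizes_multiple (4 * b) T].
  move=> cJ dJ; exists (\bigcup_(k in J) B k); split; first by apply/bigcupsP.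
    by rewrite (card_disjoint_bigcup _ dis cB) cJ mulnA.
  exists (\sum_(k in J) w k); first exact: realizes_bigcup.
  have -> : (4 * b)%N = (2 * (2 * b))%N by rewrite mulnA.
  by rewrite wE PoszM; apply: dvdz_mul.
(* At most two terms left over means at least 4b - 1 pairs, and Erdos-Ginzburg-Ziv selects 2b of
   them. Otherwise four are left over, as their number is even. *)
have [R2|R3] := leqP #|R| 2.
  have [|J [_ cJ dJ]] := egz h (U := setT) b20; first by rewrite cardsT card_ord; lia.
  exact: pairs_only dJ.
have cR4' : #|R| = 4%N by move: cR; rewrite cU; move: cR4 R3; clear; lia.
have mE : m = (4 * b - 2)%N by move: cR; rewrite cU cR4'; clear; lia.
have pick t : exists2 i, i \in R & (c i, (2 %| a i)%Z) = t.
  have : t \in [set (c i, (2 %| a i)%Z) | i in R].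
    rewrite (_ : [set _ | _ in R] = setT) ?inE //; apply/eqP.
    by rewrite eqEcard subsetT cardsT card_prod card_bool card_in_imset // cR4'.
  by case/imsetP => i iR ->; exists i.
have [i1 i1R [ci1 ai1]] := pick (true, true).
have [i2 i2R [ci2 ai2]] := pick (true, false).
have [i3 i3R [ci3 ai3]] := pick (false, true).
have [i4 i4R [ci4 ai4]] := pick (false, false).
have n12 : i1 != i2 by apply: contraFneq ai2 => <-.
have n34 : i3 != i4 by apply: contraFneq ai4 => <-.
have ncc i j : c i = true -> c j = false -> i != j by move=> ci cj; apply: contraFneq cj => <-.
pose u0 := n2 + s * a i1 + a i2 + (a i3 + a i4).
have u02 : (2 %| u0)%Z.
  have -> : u0 = n2 + (s - 1) * a i1 + a i1 + (a i2 + a i4) + a i3 by rewrite /u0; ring.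
  have e24 : (2 %| a i2 + a i4)%Z by apply: dvdz_parity; rewrite ai2 ai4.
  by dvz.
have [u1 u1E] := dvdzP u02.
(* The four leftover terms and 2b - 2 pairs make 4b terms. Working with half-values modulo [b]
   brings the total exponent to 0 modulo 2b only. *)
have [|||hitV|[e [g [eb e1 card_e]]]] :=
  @fixed_size_sums_dichotomy _ setT b (2 * b - 2) h b0; try (rewrite ?cardsT ?card_ord ?mE; clear -b0; lia).
  have [J [_ cJ dJ]] := hitV (- u1).
  pose v0 := u0 + \sum_(k in J) w k.
  have v0E : v0 = 2 * (\sum_(k in J) h k - - u1) by rewrite /v0 wE u1E; ring.
  pose T0 := \bigcup_(k in J) B k.
  have T0U : T0 \subset U by apply/bigcupsP.
  have T0R i : i \in R -> i \notin T0.
    move=> iR; apply/negP => /bigcupP[k _ ik]; have /pred0P/(_ i)/= := disR k.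
    by rewrite iR => /negP; apply.
  have rT0 : realizes T0 (\sum_(k in J) w k) by apply: realizes_bigcup.
  have r4 : realizes [set i4] (a i4) by apply: Realizes1; rewrite ci4.
  have r3T : realizes (i3 |: T0) (a i3 + \sum_(k in J) w k).
    by apply: RealizesU => //; rewrite ?disjoints1 ?T0R //; apply: Realizes1; rewrite ci3.
  have d43 : [disjoint [set i4] & i3 |: T0] by rewrite disjoints1 in_setU1 negb_or T0R // eq_sym n34.
  have d0 : [disjoint set0 & i4 |: (i3 |: T0)] by rewrite -setI_eq0 set0I.
  have not34 i : i \in R -> c i = true -> i \notin i4 |: (i3 |: T0).
    by move=> iR ci; rewrite !in_setU1 !negb_or T0R // !ncc.
  exists (i1 |: (i2 |: (i4 |: (i3 |: T0)))); split.
  - rewrite !subUset !sub1set T0U !(subsetP RU) //.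
  - have n1 : i1 \notin i2 |: (i4 |: (i3 |: T0)) by rewrite in_setU1 negb_or n12 not34.
    rewrite cardsU1 n1 cardsU1 not34 // cardsU1 in_setU1 negb_or eq_sym n34 T0R // cardsU1 T0R //.
    by rewrite (card_disjoint_bigcup _ dis cB) cJ /=; clear -b0; lia.
  have [v04|v04] := boolP ((4 * b)%N %| v0)%Z.
    exists v0 => //; have -> : v0 = n2 + s * (a i1 + 0) + a i2 + (a i4 + (a i3 + \sum_(k in J) w k)).
      by rewrite /v0 /u0; ring.
    have -> : i1 |: (i2 |: (i4 |: (i3 |: T0))) = i1 |: (i2 |: (set0 :|: (i4 |: (i3 |: T0)))) by rewrite set0U.
    apply: realizes_sandwich => //; rewrite ?set0U ?not34 //; first exact: Realizes0.
    exact: RealizesU.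
  (* If the total is 2b modulo 4b, moving [i4] between [i1] and [i2] adds (s - 1) * a i4, which is
     again 2b because [a i4] is odd. *)
  exists (n2 + s * (a i1 + a i4) + a i2 + (a i3 + \sum_(k in J) w k)).
    by apply: realizes_sandwich => //; apply: not34.
  have -> : n2 + s * (a i1 + a i4) + a i2 + (a i3 + \sum_(k in J) w k) = v0 + (s - 1) * a i4.
    by rewrite /v0 /u0; ring.
  have [z zE] := dvdzP sb; have [t tE] := dvdzP dJ.
  have oddt : ~~ (2 %| t)%Z.
    apply: contra v04 => /dvdzP[t' t'E]; rewrite v0E tE t'E.
    by apply/dvdzP; exists t'; rewrite ?Posz2 ?Posz4; ring.
  have a4E : a i4 = 2 * (a i4 %/ 2)%Z + 1 by move: ai4; clear; lia.
  have tE' : t = 2 * (t %/ 2)%Z + 1 by move: oddt; clear; lia.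
  apply/dvdzP; exists ((t %/ 2)%Z + 1 + z * a i4 + (a i4 %/ 2)%Z).
  have -> : s - 1 = z * (4 * b)%N%:Z + (2 * b)%N%:Z by rewrite -zE subrK.
  rewrite v0E tE ?Posz2 ?Posz4; move: (t %/ 2)%Z (a i4 %/ 2)%Z tE' a4E => t' a4' -> ->; ring.
pose V := [set k : 'I_m | (e %| h k - g)%Z].
have cV : (4 * b - e <= #|V|)%N.
  have : (#|V| + #|~: V| = 4 * b - 2)%N by rewrite cardsC card_ord.
  move: card_e.
  rewrite (_ : [set _ in _ | _] = ~: V); last by apply/setP => k; rewrite !inE.
  by clear; lia.
have eb2 : (e %| 2 * b)%N by rewrite dvdn_mull.
have [||J [_ cJ dJ]] := @egz_coset _ h (2 * b) e (2 * b) g V b20 eb2 (dvdnn _) b20.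
- by move=> k; rewrite inE.
- have [y bE] := dvdnP eb; have e0 : (0 < e)%N by apply: ltnW.
  have -> : (2 * b %/ e = 2 * y)%N by rewrite bE mulnA mulnK.
  have y0 : (0 < y)%N by move: b0; rewrite bE muln_gt0 => /andP[].
  have h2 : (e + 2 * y <= 2 * (y * e) + 1)%N by move: e1 y0; clear; nia.
  by move: cV h2; rewrite bE; move: (y * e)%N; clear; lia.
exact: pairs_only dJ.
Qed.

Lemma four_dvd_realizes : (4 %| n)%N -> (0 < n)%N -> (n %| s ^+ 2 - 1)%Z -> ~~ (n %| s - 1)%Z ->
  forall U, (2 * n <= #|U|)%N -> exists T, [/\ T \subset U, #|T| = n & realizes_multiple n T].
Proof.
move=> n4 n0 s2 s1.
have n2_2 : (2 %| n2)%Z by rewrite dvdzE /=; have [k ->] := dvdnP n4; rewrite (_ : (k * 4 = k * 2 * 2)%N) ?mulnK ?dvdn_mull // -mulnA.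
have n_2 : (2 %| n)%N by apply: dvdn_trans n4.
have sE : s ^+ 2 - 1 = (s - 1) * (s + 1) by ring.
have s_odd : (2 %| s - 1)%Z.
  have : (2 %| s ^+ 2 - 1)%Z by apply: dvdz_trans s2; rewrite dvdzE.
  rewrite sE dvdzE abszM Euclid_dvdM // -[X in X || _]/(2 %| s - 1)%Z -[X in _ || X]/(2 %| s + 1)%Z.
  case/orP => // s1'; have -> : s - 1 = (s + 1) - 2 by ring.
  exact: rpredB.
have [/existsP[p /and3P[pr_p odd_p /andP[pn ps]]]|noodd] :=
  boolP [exists p : 'I_n.+1, [&& prime p, odd p, (p %| n)%N & ~~ (p %| s - 1)%Z]].
  move: (p : nat) pr_p odd_p pn ps => {}p pr_p odd_p pn ps.
  have sp : (p %| s + 1)%Z.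
    have : (p %| s ^+ 2 - 1)%Z by apply: dvdz_trans s2; rewrite dvdzE.
    by rewrite sE dvdzE abszM Euclid_dvdM // -!dvdzE (negPf ps).
  have cop4 : coprime (2 ^ 2) p by rewrite coprimeXl // coprime2n.
  have pn4 : (4 * p %| n)%N by rewrite (Gauss_dvd _ cop4) n4.
  have [k nE] := dvdnP pn4.
  have p20 : (0 < 2 * p)%N by rewrite muln_gt0 (prime_gt0 pr_p).
  have n2E : (n %/ 2 = k * (2 * p))%N by rewrite nE (_ : (k * (4 * p) = k * (2 * p) * 2)%N) ?mulnK //; lia.
  apply: (@lift_divisor _ c a n s (2 * p)) => //.
    by apply/dvdnP; exists (2 * k)%N; rewrite nE; lia.
  move=> U le_U; apply: odd_prime_base => //; last by move: le_U; clear; lia.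
  by rewrite n2E PoszM dvdz_mull.
have ps p : prime p -> odd p -> (p %| n)%N -> (p %| s - 1)%Z.
  move=> pr_p odd_p pn; apply: contraNT noodd => nps; apply/existsP.
  have lt : (p < n.+1)%N by rewrite ltnS dvdn_leq.
  by exists (Ordinal lt); rewrite /= pr_p odd_p pn.
(* Every odd prime divisor of [n] now divides s - 1, hence not s + 1. So the odd part of [n] divides
   s - 1, and the power of 2 in [n] does not. *)
pose o := (n`_2^')%N.
have os : (o %| s - 1)%Z.
  have cop : coprimez o (s + 1).
    rewrite coprimezE /= /coprime; apply/eqP/eqP; apply: contraT => ne1.
    pose p := pdiv (gcdn o (absz (s + 1)%R)).
    have pr_p : prime p by apply: pdiv_prime; rewrite ltn_neqAle eq_sym ne1 gcdn_gt0 part_gt0.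
    have pg : (p %| gcdn o (absz (s + 1)%R))%N by apply: pdiv_dvd.
    have po : (p %| o)%N by apply: dvdn_trans pg (dvdn_gcdl _ _).
    have o2 : ~~ (2 %| o)%N by rewrite -p'natE // part_pnat.
    have p2 : p != 2%N by apply: contraTneq po => ->.
    have odd_p : odd p by case: (even_prime pr_p) => // e2; rewrite e2 in p2.
    have psm := ps p pr_p odd_p (dvdn_trans po (dvdn_part _ _)).
    have psp : (p %| s + 1)%Z by rewrite dvdzE; apply: dvdn_trans pg (dvdn_gcdr _ _).
    have : (p %| (s + 1) - (s - 1))%Z by apply: rpredB.
    have -> : (s + 1) - (s - 1) = 2 by ring.
    by rewrite dvdzE /= (dvdn_prime2 pr_p) // (negPf p2).
  have : (o %| s ^+ 2 - 1)%Z by apply: dvdz_trans s2; rewrite dvdzE dvdn_part.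
  by rewrite sE Gauss_dvdzl.
pose e := logn 2 n.
have nE : n = (2 ^ e * o)%N by rewrite -p_part partnC.
have bad : exists f, ~~ ((2 ^ f)%N %| s - 1)%Z.
  exists e; apply: contra s1 => es; rewrite nE PoszM Gauss_dvdz ?es //.
  by rewrite coprimezE /= -p_part coprime_partC.
(* By minimality s - 1 is an odd multiple of 2^(f-1), that is, s = 1 + 2b modulo 4b with b =
   2^(f-2). *)
case: (ex_minnP bad) => f fbad minf.
have f2 : (1 < f)%N by case: f fbad {minf} => [|[|]] //; rewrite ?expn0 ?dvd1z // expn1 s_odd.
have fgood : ((2 ^ f.-1)%N %| s - 1)%Z.
  by apply/negPn/negP => /minf; case: f f2 {fbad minf} => //= f; rewrite ltnn.
have fe : (f <= e)%N.
  apply: minf; apply: contra s1 => es; rewrite nE PoszM Gauss_dvdz ?es //.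
  by rewrite coprimezE /= -p_part coprime_partC.
pose b := (2 ^ (f - 2))%N.
have b4 : (4 * b = 2 ^ f)%N by rewrite /b -(expnD 2 2) subnKC.
have b2 : (2 * b = 2 ^ f.-1)%N by rewrite /b -expnS; congr (2 ^ _)%N; move: f2; clear; lia.
have b0 : (0 < b)%N by rewrite expn_gt0.
apply: (@lift_divisor _ c a n s (4 * b)) => //.
  by rewrite b4 nE dvdn_mulr // dvdn_exp2l.
move=> U le_U; apply: two_power_base => //.
have [z zE] := dvdzP fgood; rewrite zE -b2; rewrite zE -b2 -b4 in fbad.
have oddz : ~~ (2 %| z)%Z.
  by apply: contra fbad => /dvdzP[t ->]; apply/dvdzP; exists t; rewrite ?Posz2 ?Posz4; ring.
apply/dvdzP; exists (z %/ 2)%Z.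
have {1}-> : z = 2 * (z %/ 2)%Z + 1 by move: oddz; clear; lia.
by rewrite ?Posz2 ?Posz4; ring.
Qed.

(** For E: 2n of the 3n terms remain after removing one block of length [n], enough for a second
    one. *)
Lemma four_dvd_realizes_double : (4 %| n)%N -> (0 < n)%N -> (n %| s ^+ 2 - 1)%Z -> ~~ (n %| s - 1)%Z ->
  (3 * n <= #|I|)%N -> exists T, #|T| = (2 * n)%N /\ realizes_multiple n T.
Proof.
move=> n4 n0 s2 s1 le_I.
have [|B [dis _ cB rB]] := extract_blocks (four_dvd_realizes n4 n0 s2 s1) (j := 2) (U := setT).
  by rewrite cardsT; move: le_I; clear; lia.
exists (\bigcup_(k in setT) B k).
rewrite (card_disjoint_bigcup _ dis cB) cardsT card_ord mulnC; split=> //.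
have [v rv nv] := fin_all_exists2 rB.
exists (\sum_(k in setT) v k); first exact: realizes_bigcup.
by apply: rpred_sum.
Qed.

End FourDividesMain.

(** * The case n = 2 modulo 4 *)

Section TwoModFour.
Variables (I : finType) (c : pred I) (a : I -> int) (n k l : nat) (s : int).
Hypotheses (odd_k : odd k) (odd_l : odd l) (k3 : (2 < k)%N) (l3 : (2 < l)%N)
  (cop : coprime k l) (nE : n = (2 * (k * l))%N)
  (sl : (l %| s + 1)%Z) (sk : ((2 * k)%N %| s - 1)%Z).
Implicit Types (T U V M J F : {set I}) (u v g : int) (e h : nat).
Local Notation realizes := (realizes c a n s).
Local Notation realizes_multiple := (realizes_multiple c a n s).
Local Notation pair_value := (pair_value c a n s).
Local Notation n2 := ((n %/ 2)%N%:Z).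
Local Notation goal := (exists T, #|T| = (2 * n)%N /\ realizes_multiple n T).

Let n2E : n2 = (k * l)%N. Proof. by rewrite nE mulKn. Qed.
Let k0 : (0 < k)%N. Proof. exact: ltnW (ltnW k3). Qed.
Let l0 : (0 < l)%N. Proof. exact: ltnW (ltnW l3). Qed.
Let n0 : (0 < n)%N. Proof. by rewrite nE !muln_gt0 k0 l0. Qed.
Let cop2l : coprime (2 * k) l. Proof. by rewrite coprimeMl coprime2n odd_l. Qed.
Let n_split : n = ((2 * k) * l)%N. Proof. by rewrite nE mulnA. Qed.

Let odd_half e u : odd e -> (e %| 2 * u)%Z = (e %| u)%Z.
Proof. by move=> oe; rewrite Gauss_dvdzr // coprimezE; apply: (etrans (coprimen2 e) oe). Qed.

Let even_half e u : ((2 * e)%N %| 2 * u)%Z = (e %| u)%Z.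
Proof. by rewrite PoszM dvdz_mul2l. Qed.

(* The class of the element of index [i] in the cyclic quotient of order [4k] by the subgroup of order [l]. *)
Definition theta i : int := if c i then (k * l)%N%:Z + 2 * a i else 2 * a i.

Lemma theta_odd i : (2 %| theta i)%Z = ~~ c i.
Proof.
rewrite /theta; case: (c i) => /=; last by rewrite dvdz_mulr.
have : odd (k * l) by rewrite oddM odd_k.
by clear; lia.
Qed.

Lemma noncoset_case V (q : nat) g : (forall i, i \in V -> ~~ c i) -> (q %| n)%N ->
  (forall i, i \in V -> (q %| a i - g)%Z) -> (2 * n + n %/ q <= #|V| + 1)%N -> goal.
Proof.
move=> Vc qn Vg leV.
have [|T [TV cT dT]] := egz_coset n0 qn (dvdn_mull 2 (dvdnn n)) _ Vg leV.
  by rewrite muln_gt0.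
exists T; split=> //; exists (\sum_(i in T) a i) => //.
by apply: realizes_setC => i /(subsetP TV)/Vc.
Qed.

(** Terms of x<y> are paired by their exponent modulo [e]; as s = -1 and n/2 = 0 there, every pair
    value is 0 modulo [e]. All pair values then lie in one class modulo [e * h]. At most e + 1 terms
    stay unpaired, so n + n/(eh) - 1 pairs are available. *)
Lemma pairs_case V (e h : nat) g : (0 < e)%N -> (e %| l)%N -> (h %| 2 * k)%N ->
  (forall i, i \in V -> ~~ c i -> (e %| a i)%Z) ->
  (forall i j, i \in V -> j \in V -> c i = c j -> (h %| pair_value i j - g)%Z) ->
  (2 * n + 2 * (n %/ (e * h)) + e <= #|V| + 1)%N -> goal.
Proof.
move=> e0 el hk Ve Vh leV.
have e0' : (e : int) != 0 by move: e0; clear; lia.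
have lt_mod z : (`|(z %% e)%Z| < e.+1)%N.
  have := ltz_mod z e0'; have := modz_ge0 z e0'; move: (z %% e)%Z; clear; lia.
(* [ord_max] exceeds every residue modulo [e], and serves as the single class of the terms of
   <y>. *)
pose cl i : 'I_e.+1 := if c i then Ordinal (lt_mod (a i)) else ord_max.
have [m [f1 [f2 [R [dis fV RV injR [disR cR]]]]]] := pair_up cl V.
have cR' : (#|R| <= e.+1)%N.
  by rewrite -(card_in_imset injR) -[X in (_ <= X)%N]card_ord max_card.
have lt_e z : (`|(z %% e)%Z| < e)%N.
  have := ltz_mod z e0'; have := modz_ge0 z e0'; move: (z %% e)%Z; clear; lia.
have clP i j : cl i = cl j -> c i = c j /\ (c i -> (e %| a i - a j)%Z).
  rewrite /cl; case: (c i); case: (c j) => // /(congr1 val) /= E.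
  - split=> // _; rewrite -eqz_mod_dvd; apply/eqP.
    have := modz_ge0 (a i) e0'; have := modz_ge0 (a j) e0'; move: E.
    by move: (a i %% e)%Z (a j %% e)%Z; clear; lia.
  - by have := lt_e (a i); rewrite E ltnn.
  - by have := lt_e (a j); rewrite -E ltnn.
have eh_n : (e * h %| n)%N by rewrite n_split mulnC dvdn_mul.
have eh0 : (0 < e * h)%N by apply: dvdn_gt0 eh_n.
pose B k := [set f1 k; f2 k]; pose w k := pair_value (f1 k) (f2 k).
have cB i : #|B i| = 2%N by have [_ _ neq _] := fV i; rewrite cards2 neq.
have rB i : realizes (B i) (w i).
  by have [_ _ ? /clP[? _]] := fV i; apply: realizes_pair_value.
have we i : (e %| w i)%Z.
  have [p1 p2 _ /clP[cc ac]] := fV i.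
  have es : (e %| s + 1)%Z by apply: dvdz_trans sl.
  have en2 : (e %| n2)%Z by rewrite n2E dvdzE /= dvdn_mull.
  rewrite /w /pair_value; case: (boolP (c (f1 i))) => ci.
    have aa := ac ci.
    have -> : n2 + s * a (f1 i) + a (f2 i) = n2 + (s + 1) * a (f1 i) - (a (f1 i) - a (f2 i)) by ring.
    dvz.
  by apply: rpredD; apply: Ve => //; rewrite -cc.
have wh i : (h %| w i - g)%Z by have [? ? _ /clP[? _]] := fV i; apply: Vh.
have coph : coprimez e h.
  by rewrite coprimezE /= coprime_sym; apply: coprime_dvdl hk (coprime_dvdr el cop2l).
have qp : (0 < n %/ (e * h))%N by rewrite divn_gt0 // dvdn_leq.
have m_big : (n + n %/ (e * h) <= m + 1)%N by move: leV cR cR'; clear; lia.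
have m0 : (0 < m)%N by move: m_big qp n0; clear; lia.
have weh i : i \in [set: 'I_m] -> ((e * h)%N %| w i - w (Ordinal m0))%Z.
  move=> _; rewrite PoszM Gauss_dvdz // rpredB //=.
  have -> : w i - w (Ordinal m0) = (w i - g) - (w (Ordinal m0) - g) by ring.
  exact: rpredB.
have [|J [_ cJ dJ]] := egz_coset n0 eh_n (dvdnn n) n0 weh.
  by rewrite cardsT card_ord.
exists (\bigcup_(i in J) B i); split; first by rewrite (card_disjoint_bigcup _ dis cB) cJ.
by exists (\sum_(i in J) w i) => //; apply: realizes_bigcup.
Qed.

(** In the quotient of order 4k the element [y] has class 2, so a pair with product y^w has class
    2w. *)
Lemma pair_value_theta i j : c i = c j ->
  ((4 * k)%N %| 2 * pair_value i j - (theta i + theta j))%Z.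
Proof.
rewrite /pair_value /theta => <-; case: (c i); last first.
  by rewrite mulrDr subrr dvdz0.
have -> : 2 * (n2 + s * a i + a j) - ((k * l)%N%:Z + 2 * a i + ((k * l)%N%:Z + 2 * a j)) = (s - 1) * a i * 2.
  by rewrite n2E; ring.
rewrite (_ : (4 * k)%N = (2 * k * 2)%N); last by rewrite mulnAC.
by rewrite PoszM dvdz_mul // dvdz_mulr.
Qed.

(* The flips [a i -> s a i] of the terms of [F] shift the product by multiples of
   [s - 1 = -2] modulo [l] and do not change it modulo [2k]. *)
Lemma flip_case F b T : F \subset T -> (forall i, i \in F -> ~~ c i) -> (forall t, hits l a F t) ->
  b \in T -> c b -> #|T| = (2 * n)%N -> ((4 * k)%N %| \sum_(i in T) theta i)%Z -> goal.
Proof.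
move=> FT Fc hitF bT cb cT dT.
pose C := [set i in T | c i]; pose N := [set i in T | ~~ c i].
have disCN : [disjoint C & N].
  by apply/pred0P => i /=; rewrite !inE; case: (c i); rewrite ?andbF.
have CNE : C :|: N = T by apply/setP => i; rewrite !inE; case: (c i); rewrite ?andbF ?andbT ?orbF.
have sumT : \sum_(i in T) theta i = (k * l)%N%:Z *+ #|C| + 2 * \sum_(i in C) a i + 2 * \sum_(i in N) a i.
  rewrite -CNE big_disjointU //; congr (_ + _).
    rewrite -sumr_const mulr_sumr -big_split; apply: eq_bigr => i.
    by rewrite inE /theta => /andP[_ ->].
  rewrite mulr_sumr; apply: eq_bigr => i; by rewrite inE /theta => /andP[_ /negPf ->].
(* Only terms of x<y> have odd class. The zero sum thus makes their number even, and [b] has a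
   partner. *)
have evenC : ~~ odd #|C|.
  have : (2 %| \sum_(i in T) theta i)%Z.
    by apply: dvdz_trans dT; rewrite dvdzE /= dvdn_mulr.
  have -> : odd #|C| = odd (k * l * #|C|) by rewrite !oddM odd_k odd_l.
  have -> : \sum_(i in T) theta i = (k * l * #|C|)%N%:Z + 2 * (\sum_(i in C) a i + \sum_(i in N) a i).
    by rewrite sumT -mulr_natr natz PoszM; ring.
  move: (k * l * #|C|)%N (\sum_(i in C) a i + \sum_(i in N) a i); clear => x v; lia.
have bC : b \in C by rewrite inE bT.
have /set0Pn[b' b'C] : C :\ b != set0.
  rewrite -cards_eq0; apply: contra evenC => /eqP C0.
  by rewrite (cardsD1 b) bC C0.
have [b'b b'C'] : b' != b /\ b' \in C by move: b'C; rewrite in_setD1 => /andP[].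
have [b'T cb'] : b' \in T /\ c b' by move: b'C'; rewrite inE => /andP[].
pose C' := C :\ b :\ b'.
have cC' : #|C| = #|C'|.+2 by rewrite (cardsD1 b) bC (cardsD1 b') b'C.
have C'C : C' \subset C by apply: subset_trans (subsetDl _ _) (subsetDl _ _).
have evenC' : ~~ odd #|C'| by move: evenC; rewrite cC' /= negbK.
have [|u ru du] := @realizes_even_coset _ c a n s C' _ evenC'.
  by move=> i /(subsetP C'C); rewrite inE => /andP[].
have sumC : \sum_(i in C) a i = a b + (a b' + \sum_(i in C') a i).
  by rewrite -(setD1K bC) big_setU1 ?setD11 //= -(setD1K b'C) big_setU1 ?setD11.
pose v0 := n2 + s * a b + a b' + \sum_(i in N) a i + u.
(* [z] inverts 2 modulo [l]: flipping terms of total exponent v0 * z subtracts v0. *)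
pose z := (l.+1)./2%:Z; have zE : 2 * z = l%:Z + 1.
  by rewrite /z; move: odd_l; clear; lia.
have [J JF hJ] := hitsP _ _ _ _ (hitF (v0 * z)).
have JN : J \subset N.
  by apply/subsetP => i /(subsetP JF) iF; rewrite inE (subsetP FT) //= Fc.
pose O := (N :\: J) :|: C'.
have rO : realizes O (\sum_(i in N :\: J) a i + u).
  apply: RealizesU ru; last first.
    by apply: realizes_setC => i; rewrite !inE => /and3P[].
  apply: disjointWl (subsetDl _ _) _; rewrite disjoint_sym; exact: disjointWl C'C disCN.
have JO : J :|: O = N :|: C' by rewrite /O setUA -[N in RHS](setID N J) (setIidPr JN).
have disJO : [disjoint J & O].
  rewrite disjoint_sym disjoints_subset subUset subsetDr /= -disjoints_subset.
  exact: disjointWl C'C (disjointWr JN disCN).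
have TE : b |: (b' |: (J :|: O)) = T.
  by rewrite JO (setUC N) setUA setUA -(setUA [set b]) (setD1K b'C) (setD1K bC).
have notN i : c i -> i \notin N by rewrite inE => ->; rewrite andbF.
have bO : b \notin J :|: O by rewrite JO in_setU negb_or notN //= !in_setD1 eqxx andbF.
have b'O : b' \notin J :|: O by rewrite JO in_setU negb_or notN //= in_setD1 eqxx.
exists T; split=> //; exists (n2 + s * (a b + \sum_(i in J) a i) + a b' + (\sum_(i in N :\: J) a i + u)).
  rewrite -[in X in realizes X _]TE; apply: realizes_sandwich => //; first by rewrite eq_sym.
  by apply: realizes_setC => i /(subsetP JN); rewrite inE => /andP[].
have sumN : \sum_(i in N) a i = \sum_(i in J) a i + \sum_(i in N :\: J) a i.
  by rewrite (big_setID J) /= (setIidPr JN).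
have -> : n2 + s * (a b + \sum_(i in J) a i) + a b' + (\sum_(i in N :\: J) a i + u)
  = v0 + (s - 1) * \sum_(i in J) a i by rewrite /v0 sumN; ring.
rewrite n_split PoszM Gauss_dvdz //; apply/andP; split.
  have du' := du _ sk.
  pose W := n2 + a b + a b' + \sum_(i in N) a i + (n2 *+ #|C'|./2 + \sum_(i in C') a i).
  have dW : ((2 * k)%N %| W)%Z.
    rewrite -even_half (_ : (2 * (2 * k))%N = (4 * k)%N); last by rewrite mulnA.
    suff -> : 2 * W = \sum_(i in T) theta i by [].
    rewrite sumT cC' sumC /W -n2E.
    have -> : #|C'|.+2 = (#|C'|./2 + #|C'|./2 + 2)%N.
      by rewrite addnn -[X in X.+2](odd_double_half #|C'|) (negPf evenC') add0n addn2.
    by rewrite !mulrnDr; ring.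
  have -> : v0 + (s - 1) * \sum_(i in J) a i = W + (s - 1) * (a b + \sum_(i in J) a i)
     + (u - (n2 *+ #|C'|./2 + \sum_(i in C') a i)) by rewrite /v0 /W; ring.
  apply: rpredD du'; apply: rpredD dW _; exact: dvdz_mulr.
have -> : v0 + (s - 1) * \sum_(i in J) a i = (s + 1) * \sum_(i in J) a i
   - 2 * (\sum_(i in J) a i - v0 * z) - v0 * (2 * z - 1) by ring.
have ll : (l %| 2 * z - 1)%Z by rewrite zE addrK.
by dvz.
Qed.

(* Choose [h] maximal among the divisors of [k] such that almost all terms lie in one
   class modulo [h] of the quotient of order [4k]. A further concentration modulo
   [h * e] with [e] odd would contradict maximality; with [e] even, the concentrated
   terms all lie in [<y>] or all lie in its other coset. *)
Lemma two_mod_four_realizes : (3 * n <= #|I|)%N -> goal.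
Proof.
move=> le_I; pose N0 := [set i | ~~ c i].
have cN0 : (#|[set i | c i]| + #|N0| = #|I|)%N.
  rewrite -(cardsC [set i | c i]); congr (_ + #|pred_of_set _|)%N.
  by apply/setP => i; rewrite !inE.
have [c1|c2] := leqP #|[set i | c i]| 1.
  apply: (@noncoset_case N0 1 0) => [i|||]; rewrite ?dvd1n ?divn1 //.
  - by rewrite inE.
  - by move: le_I cN0 c1; clear; lia.
(* [L] is the weight that keeps [h * e] good for odd [e]: the (h * e - h)L additional exceptions
   must accommodate at most [l] prescribed terms and e - 2 others, already for h = 1 and e = 3. *)
pose L := (l.+1)./2; have lE : l = (2 * L - 1)%N by rewrite /L; move: odd_l; clear; lia.
have L1 : (1 < L)%N by move: lE l3; clear; lia.
pose good h := (h %| k)%N && [exists g : 'I_(4 * k),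
  (#|[set i | ~~ (h %| (theta i - (g : nat)%:Z)%R)%Z]| <= (h - 1) * L)%N].
have k40 : (0 < 4 * k)%N by rewrite muln_gt0.
have good1 : exists h, good h.
  exists 1%N; rewrite /good dvd1n /=; apply/existsP; exists (Ordinal k40).
  rewrite (_ : [set _ | _] = set0) ?cards0 //.
  by apply/setP => i; rewrite !inE dvd1z.
have le_good h : good h -> (h <= k)%N by case/andP => /dvdn_leq ->.
case: (ex_maxnP good1 le_good) => h /andP[hk /existsP[g' card_h]] max_h.
move: {g'}(g' : nat)%:Z card_h => g card_h.
have h0 : (0 < h)%N by apply: dvdn_gt0 hk.
have [k' kE'] := dvdnP hk; have kE : k = (h * k')%N by rewrite mulnC.
have k'0 : (0 < k')%N by move: k0; rewrite kE muln_gt0 => /andP[].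
have hk3 : (2 < h * k')%N by rewrite -kE.
have odd_h : odd h by move: odd_k; rewrite kE oddM => /andP[].
have nE3 : n = (2 * (h * k' * (2 * L - 1)))%N by rewrite -kE -lE.
have h2k : (h %| 2 * k)%N by rewrite dvdn_mull.
have h4k : (h %| 4 * k)%N by rewrite dvdn_mull.
pose SK := [set i | (h %| theta i - g)%Z].
have cSK : (3 * n <= #|SK| + (h - 1) * L)%N.
  apply: leq_trans le_I _; rewrite -(cardsC SK) leq_add2l.
  by rewrite (_ : ~: SK = [set i | ~~ (h %| theta i - g)%Z]) //; apply/setP => i; rewrite !inE.
have pair_h (h' : nat) (V : {set I}) g2 : (h' %| 4 * k)%N -> (forall i, i \in V -> (h' %| theta i - g2)%Z) ->
    forall i j, i \in V -> j \in V -> c i = c j -> (h' %| 2 * (pair_value i j - g2))%Z.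
  move=> h'k HV i j iV jV cij.
  have -> : 2 * (pair_value i j - g2) = (2 * pair_value i j - (theta i + theta j)) + (theta i - g2) + (theta j - g2) by ring.
  apply: rpredD (HV j jV); apply: rpredD (HV i iV).
  by apply: dvdz_trans (pair_value_theta cij); rewrite dvdzE.
pose N := [set i in SK | ~~ c i].
case: (subset_sums_dichotomy a N l0) => [[e [el e1 card_e]]|[F [FN ltF hitF]]].
  pose V := [set i in SK | c i || (e %| a i)%Z].
  have cV : (#|SK| + 2 <= #|V| + e)%N.
    have SKV : SK \subset V :|: [set i in N | ~~ (e %| a i)%Z].
      by apply/subsetP => i iS; rewrite !inE in iS *; rewrite iS; case: (c i); case: (_ %| a i)%Z.
    have := leq_trans (subset_leq_card SKV) (leq_card_setU _ _); move: card_e; clear; lia.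
  have e3 : (2 < e)%N.
    have : odd e by have [l' lE'] := dvdnP el; move: odd_l; rewrite lE' oddM => /andP[].
    by move: e1; clear; case: e => [|[|[|]]].
  have e0 : (0 < e)%N by apply: ltnW.
  have [l' lE'] := dvdnP el; have lel : (e * l' = 2 * L - 1)%N by rewrite -lE lE' mulnC.
  apply: (@pairs_case V e h g) => //.
  - by move=> i; rewrite inE => /andP[_ /orP[->|]].
  - move=> i j iV jV cij; rewrite -(odd_half _ odd_h).
    by apply: (pair_h h V g) => // i'; rewrite inE => /andP[]; rewrite inE.
  - have -> : (n %/ (e * h) = 2 * (k' * l'))%N.
      by rewrite nE3 -lel (_ : 2 * _ = 2 * (k' * l') * (e * h))%N ?mulnK ?muln_gt0 ?e0 //; clear; lia.
    have := bound_pairs hk3 e3 odd_h lel L1; move: cSK cV; rewrite nE3 lel; clear.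
    by move: (k' * l')%N ((h - 1) * L)%N (h * k' * (2 * L - 1))%N => *; lia.
have FSK : F \subset SK by apply: subset_trans FN _; apply/subsetP => i; rewrite inE => /andP[].
have Fc i : i \in F -> ~~ c i by move/(subsetP FN); rewrite inE => /andP[].
have [/existsP[b /andP[bSK cb]]|nob] := boolP [exists b, (b \in SK) && c b]; last first.
  have noc i : i \in SK -> ~~ c i.
    by move=> iS; apply: contraNN nob => ci; apply/existsP; exists i; rewrite iS.
  (* Terms in x<y> exist but none is in the class, so h is not 1; it is odd, hence at least 3. *)
  have h3 : (2 < h)%N.
    have h1 : h != 1%N.
      apply/negP => /eqP h1; have /card_gt0P[i] : (0 < #|[set i | c i]|)%N by apply: ltnW.
      by rewrite inE => ci; have := noc i; rewrite inE h1 dvd1z ci => /(_ isT).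
    by move: h1 odd_h h0; clear; case: h => [|[|[|]]].
  have [i0 i0S] : exists i0, i0 \in SK.
    apply/set0Pn; rewrite -card_gt0; have := bound_noncoset h3 L1 k'0; move: cSK; rewrite nE3.
    have : (0 < h * k' * (2 * L - 1))%N by rewrite -lE muln_gt0 l0 -kE k0.
    by clear; move: ((h - 1) * L)%N (h * k' * _)%N (k' * _)%N => *; lia.
  apply: (@noncoset_case SK h (a i0)) => //.
  - by rewrite n_split dvdn_mulr.
  - move=> i iS; rewrite -(odd_half _ odd_h).
    have E j : j \in SK -> theta j = 2 * a j by move=> /noc/negPf; rewrite /theta => ->.
    have -> : 2 * (a i - a i0) = (theta i - g) - (theta i0 - g) by rewrite !E //; ring.
    by move: iS i0S; rewrite !inE => *; dvz.
  - have -> : (n %/ h = 2 * (k' * (2 * L - 1)))%N.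
      by rewrite nE3 (_ : 2 * _ = 2 * (k' * (2 * L - 1)) * h)%N ?mulnK //; clear; lia.
    have := bound_noncoset h3 L1 k'0; move: cSK; rewrite nE3; clear.
    by move: ((h - 1) * L)%N (h * k' * _)%N (k' * _)%N => *; lia.
have bF : b \notin F by apply/negP => /Fc; rewrite cb.
(* The terms to be prescribed: [F] provides the flips, and [b] guarantees terms of x<y> to flip
   between. *)
pose P := b |: F; have cP : #|P| = #|F|.+1 by rewrite cardsU1 bF.
have PSK : P \subset SK by rewrite subUset sub1set bSK.
pose V := SK :\: P; have cV : (#|V| + #|P| = #|SK|)%N.
  by rewrite cardsD (setIidPr PSK) subnK // subset_leq_card.
have lP : (#|P| <= 2 * L - 1)%N by rewrite cP -lE.
pose f' i := ((theta i - g) %/ h)%Z.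
have fE i : i \in SK -> theta i = f' i * h + g.
  by rewrite inE => hi; rewrite /f' divzK // subrK.
have dk0 : (0 < 4 * k')%N by rewrite muln_gt0.
have [RS1 RS2] := bound_sums hk3 odd_h L1.
have XL : (2 * L - 1 <= h * k' * (2 * L - 1))%N by rewrite leq_pmull // -kE.
have [|||hitV|[e [g1 [ed e1 card_e]]]] := @fixed_size_sums_dichotomy _ V (4 * k') (2 * n - #|P|) f' dk0.
- move: XL RS2 lP RS1; rewrite nE3; clear; move: ((h - 1) * L)%N (h * k' * _)%N => *; lia.
- move: XL RS2 lP RS1 cV cSK; rewrite nE3; clear; move: ((h - 1) * L)%N (h * k' * _)%N => *; lia.
- move: XL RS2 lP RS1 cV cSK; rewrite nE3; clear; move: ((h - 1) * L)%N (h * k' * _)%N => *; lia.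
- have [T0 [T0V cT0 dT0]] := hitV (- \sum_(i in P) f' i).
  have disPT : [disjoint P & T0].
    by rewrite disjoint_sym; apply: disjointWl T0V _; rewrite disjoints_subset subsetDr.
  have cT : #|P :|: T0| = (2 * n)%N.
    rewrite cards_disjointU // cT0 subnKC //.
    by move: XL RS2 lP RS1; rewrite nE3; clear; move: ((h - 1) * L)%N (h * k' * _)%N => *; lia.
  have TSK : P :|: T0 \subset SK by rewrite subUset PSK (subset_trans T0V) ?subsetDl.
  apply: (@flip_case F b (P :|: T0)) => //.
  + by rewrite -setUA; apply: subset_trans (subsetUl F T0) (subsetUr _ _).
  + by rewrite !inE eqxx.
  have -> : \sum_(i in P :|: T0) theta i = (\sum_(i in P :|: T0) f' i) * h + g * (2 * n)%N%:Z.
    have -> : g * (2 * n)%N%:Z = \sum_(i in P :|: T0) g by rewrite sumr_const cT -mulr_natr natz.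
    by rewrite mulr_suml -big_split; apply: eq_bigr => i /(subsetP TSK)/fE.
  apply: rpredD; last first.
    by apply: dvdz_mull; rewrite dvdzE /=; apply/dvdnP; exists l; rewrite n_split; clear; lia.
  rewrite (_ : (4 * k)%N = (4 * k' * h)%N); last by rewrite kE; clear; lia.
  rewrite PoszM dvdz_mul // big_disjointU //.
  by move: dT0; rewrite opprK addrC.
pose H := (h * e)%N; pose G := g + g1 * h.
have [y yE'] := dvdnP ed; have yE : (e * y = 4 * k')%N by rewrite mulnC.
have H4k : (H %| 4 * k)%N by rewrite kE /H; apply/dvdnP; exists y; rewrite mulnCA -yE; clear; lia.
pose V' := [set i in V | (H %| theta i - G)%Z].
have cV' : (#|V| + 2 <= #|V'| + e)%N.
  have VV' : V \subset V' :|: [set i in V | ~~ (e %| (f' i - g1)%R)%Z].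
    apply/subsetP => i iV; have iSK : i \in SK by move: iV; rewrite inE => /andP[].
    have E : (H %| theta i - G)%Z = (e %| f' i - g1)%Z.
      rewrite (fE _ iSK) (_ : f' i * h + g - G = h%:Z * (f' i - g1)); last by rewrite /G; ring.
      by rewrite /H PoszM dvdz_mul2l //; move: h0; clear; lia.
    by apply/setUP; case: (boolP (e %| f' i - g1)%Z) => He; [left|right]; rewrite in_set iV /= ?E.
  have := leq_trans (subset_leq_card VV') (leq_card_setU _ _); move: card_e; clear; lia.
have V'H i : i \in V' -> (H %| theta i - G)%Z by rewrite inE => /andP[].
have [odd_e|even_e] := boolP (odd e).
  have e3 : (2 < e)%N by move: odd_e e1; clear; case: e => [|[|[|]]].
  have Hk : (H %| k)%N.
    have copH : coprime H (2 ^ 2) by rewrite coprimeXr // coprimen2 oddM odd_h.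
    by rewrite -(Gauss_dvdr _ copH).
  have : (H <= h)%N.
    apply: max_h; rewrite /good Hk /=; have [z dz] := residueE G k40.
    apply/existsP; exists z.
    have := subset_leq_card (_ : [set i | ~~ (H %| (theta i - (z : nat)%:Z)%R)%Z] \subset ~: V').
    have /[swap]/[apply] : [set i | ~~ (H %| (theta i - (z : nat)%:Z)%R)%Z] \subset ~: V'.
      apply/subsetP => i; rewrite in_set in_setC; apply: contra => /V'H Hi.
      have -> : theta i - (z : nat)%:Z = (theta i - G) + (G - (z : nat)%:Z) by ring.
      by apply: rpredD => //; apply: dvdz_trans dz; rewrite dvdzE.
    move=> leC; apply: leq_trans leC _.
    have cSK' : (#|I| <= #|SK| + (h - 1) * L)%N.
      rewrite -(cardsC SK) leq_add2l.
      by rewrite (_ : ~: SK = [set i | ~~ (h %| theta i - g)%Z]) //; apply/setP => i; rewrite !inE.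
    have := cardsC V'; have := bound_odd_index h0 e3 L1; move: L1 cSK' cV cV' lP; rewrite -/H.
    by move: ((h - 1) * L)%N ((H - 1) * L)%N; clear; lia.
  by rewrite /H -[X in (_ <= X)%N]muln1 leq_pmul2l // leqNgt e1.
have [e2 eE] : exists e2, e = (2 * e2)%N by exists e./2; move: even_e; clear; lia.
have HE : H = (2 * (h * e2))%N by rewrite /H eE; clear; lia.
pose H' := (h * e2)%N; have H'k : (H' %| 2 * k)%N.
  by move: H4k; rewrite HE (_ : (4 * k)%N = (2 * (2 * k))%N) ?dvdn_pmul2l // mulnA.
have ye2 : (e2 * y = 2 * k')%N by move: yE; rewrite eE; clear; lia.
have H'0 : (0 < H')%N by apply: dvdn_gt0 H'k; rewrite muln_gt0.
have parity i j : i \in V' -> j \in V' -> c i = c j.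
  move=> /V'H Hi /V'H Hj; apply/negb_inj; rewrite -!theta_odd.
  have : (2 %| (theta i - G) - (theta j - G))%Z.
    apply: dvdz_trans (rpredB Hi Hj); by rewrite HE dvdzE /= dvdn_mulr.
  by move: (theta i) (theta j); clear; lia.
have [/existsP[j /andP[jV' cj]]|nocV'] := boolP [exists j, (j \in V') && c j].
  apply: (@pairs_case V' l H' G) => //.
  - by move=> i iV'; rewrite (parity _ _ iV' jV') cj.
  - move=> i j' iV' j'V' cij; rewrite -even_half -HE.
    by apply: (pair_h H V' G).
  - have -> : (n %/ (l * H') = y)%N.
      have E : (2 * (h * k') * l = y * (l * (h * e2)))%N.
        by transitivity (h * l * (e2 * y))%N; [rewrite ye2|]; clear; lia.
      by rewrite n_split kE /H' E mulnK // muln_gt0 l0.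
    have := bound_even_coset hk3 odd_h L1 yE e1; move: cSK cV cV' lP; rewrite nE3 {1}lE; clear.
    by move: ((h - 1) * L)%N (h * k' * _)%N => *; lia.
have noc i : i \in V' -> ~~ c i.
  by move=> iS; apply: contraNN nocV' => ci; apply/existsP; exists i; rewrite iS.
(* Here e = 2 allows no exception, so all terms but [b] would lie in <y>, against the two terms of
   x<y>. *)
have he : ~~ ((h == 1%N) && (e == 2%N)).
  apply/negP => /andP[/eqP h1 /eqP e2'].
  have VV' : V' = V.
    apply/eqP; rewrite eqEcard; apply/andP; split; first by apply/subsetP => i; rewrite inE => /andP[].
    by move: cV'; rewrite e2' leq_add2r.
  have : [set i | c i] \subset [set b].
    apply/subsetP => i; rewrite !inE => ci; apply/negPn/negP => ib.
    have : i \in V'.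
      rewrite VV' in_setD in_setU1 negb_or ib inE h1 dvd1z andbT /=.
      by apply/negP => /Fc; rewrite ci.
    by move/noc; rewrite ci.
  by move/subset_leq_card; rewrite cards1 leqNgt c2.
have bN := bound_even_noncoset hk3 odd_h L1 yE e1 even_e he.
have [i0 i0V] : exists i0, i0 \in V'.
  apply/set0Pn; rewrite -card_gt0; have : (0 < h * k' * (2 * L - 1))%N by rewrite -lE muln_gt0 l0 -kE k0.
  move: bN cSK cV cV' lP; rewrite nE3; clear.
  by move: ((h - 1) * L)%N (h * k' * _)%N (y * _)%N => *; lia.
apply: (@noncoset_case V' H' (a i0)) => //.
- by rewrite n_split dvdn_mulr.
- move=> i iV; rewrite -even_half -HE.
  have E j : j \in V' -> theta j = 2 * a j by move=> /noc/negPf; rewrite /theta => ->.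
  have -> : 2 * (a i - a i0) = (theta i - G) - (theta i0 - G) by rewrite !E //; ring.
  by apply: rpredB; apply: V'H.
- have -> : (n %/ H' = y * (2 * L - 1))%N.
    rewrite nE3 /H' (_ : 2 * (h * k' * (2 * L - 1)) = y * (2 * L - 1) * (h * e2))%N ?mulnK //.
    by transitivity (h * (2 * L - 1) * (e2 * y))%N; [rewrite ye2|]; move: (2 * L - 1)%N; clear => x; lia.
  move: bN cSK cV cV' lP; rewrite nE3; clear.
  by move: ((h - 1) * L)%N (h * k' * _)%N (y * _)%N => *; lia.
Qed.

End TwoModFour.

End ZeroSums.

(** * The invariants *)

Local Open Scope group_scope.

Section Sequences.
Set Implicit Arguments. Unset Strict Implicit. Unset Printing Implicit Defensive.
Variable gT : finGroupType.
Implicit Types (S T : seq gT) (G : {set gT}).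

(** If [S] has no term 1, append r - 1 of them: a product-one subsequence of length [r] still has a
    term of [S] after its ones are deleted. *)
Lemma short_of_fixed_length G (N r m : nat) : 0 < r -> N <= m + r.-1 -> 1 \in G ->
  (forall S, seq_over G S -> N <= size S -> has_k_product_one r S) ->
  forall S, seq_over G S -> m <= size S ->
    exists T, subseq_of T S /\ 1 <= size T <= r /\ product_one T.
Proof.
move=> r0 leN G1 H S GS leS.
have [S1|S1] := boolP (1 \in S).
  exists [:: 1]; split.
    have : subseq [:: 1] S by rewrite sub1seq.
    by case/subseqP => m0 _ ->; exists m0.
  by split; rewrite ?r0 //; exists [:: 1]; rewrite big_seq1.
have [||T [[m0 TE] [szT [t [tT prodt]]]]] := H (S ++ nseq r.-1 1).
- by rewrite /seq_over all_cat all_nseq; apply/andP; split=> //; apply/orP; right.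
- by rewrite size_cat size_nseq; apply: leq_trans leN _; rewrite leq_add2r.
pose p := fun g : gT => g != 1.
have sub : subseq [seq g <- T | p g] S.
  have /subseqP[m1 _ ->] : subseq [seq g <- T | p g] [seq g <- S ++ nseq r.-1 1 | p g].
    by rewrite TE subseq_filter filter_all; apply: subseq_trans (filter_subseq _ _) (mask_subseq _ _).
  rewrite filter_cat (_ : [seq g <- nseq _ _ | p g] = [::]); last first.
    by elim: (r.-1) => //= k ->; rewrite /p eqxx.
  by rewrite cats0; apply: subseq_trans (mask_subseq _ _) (filter_subseq _ _).
have cnt : count (predC p) T <= r.-1.
  have : count (predC p) T <= count (predC p) (S ++ nseq r.-1 1).
    by rewrite TE; apply: leq_count_subseq; apply: mask_subseq.
  rewrite count_cat count_nseq /= {1}(_ : count _ S = 0) => [|]; first by rewrite /p eqxx mul1n.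
  apply/eqP; rewrite -leqn0 leqNgt -has_count; apply/hasPn => g gS; rewrite /= negbK.
  by apply: contraNneq S1 => <-.
have szp : size [seq g <- T | p g] = r - count (predC p) T.
  by rewrite size_filter -szT -(count_predC p T) addnK.
exists [seq g <- T | p g]; split; first by case/subseqP: sub => m1 _ ->; exists m1.
split; first by rewrite szp leq_subr subn_gt0 andbT; move: cnt r0; clear; lia.
exists [seq g <- t | p g]; split; first exact: perm_filter.
rewrite big_filter big_mkcond -[RHS]prodt.
by apply: eq_bigr => g _; rewrite /p; case: eqP.
Qed.

End Sequences.

(** * Structure and exponent of the group, extremal sequences *)

Section Metacyclic.
Import GRing.Theory Num.Theory.
Set Implicit Arguments. Unset Strict Implicit. Unset Printing Implicit Defensive.
Variables (n : nat) (s : int) (gT : finGroupType) (G : {group gT}) (x y : gT).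
Hypotheses (n8 : 8 <= n) (even_n : ~~ odd n)
  (GE : G :=: <<[set x; y]>>) (x2 : x ^+ 2 = y ^+ (n %/ 2)) (yn : y ^+ n = 1)
  (yx : y * x = x * y ^+ (absz (s %% n%:Z)%Z)) (cG : #|G| = (2 * n)%N).
Implicit Types (S T : seq gT).

Let n0 : 0 < n. Proof. exact: leq_trans n8. Qed.

Lemma xG : x \in G. Proof. by rewrite GE mem_gen // !inE eqxx. Qed.
Lemma yG : y \in G. Proof. by rewrite GE mem_gen // !inE eqxx orbT. Qed.

Lemma normal_form g : g \in G -> exists u : bool * nat, g = x ^+ u.1 * y ^+ u.2.
Proof.
have nx : x \in 'N(<[y]>).
  by rewrite inE -cycleJ cycle_subG conjgE mulgA -mulgA yx mulKg mem_cycle.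
have -> : G :=: (<[x]> * <[y]>)%g.
  rewrite GE -norm_joinEl ?cycle_subG //.
  by rewrite /cycle joing_idl joing_idr.
case/mulsgP => _ _ /cycleP[i ->] /cycleP[j ->] ->.
exists (odd i, (n %/ 2 * i./2 + j)%N) => /=.
rewrite -{1}(odd_double_half i) expgD -mul2n expgM x2 -expgM expgD mulgA //.
Qed.

(** The normal form gives at most 2 * #[y] elements, and the group has 2n. *)
Lemma order_y : #[y] = n.
Proof.
have yn' : #[y] %| n by rewrite order_dvdn yn.
apply/eqP; rewrite eqn_leq dvdn_leq //=.
have : #|G| <= #|[set x ^+ (u.1 : bool) * u.2 | u in setX [set: bool] <[y]>]|.
  apply: subset_leq_card; apply/subsetP => g /normal_form[[u v] ->] /=.
  by apply/imsetP; exists (u, y ^+ v); rewrite // !inE /= mem_cycle.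
move/leq_trans/(_ (leq_imset_card _ _)); rewrite cG cardsX cardsT card_bool.
by rewrite leq_pmul2l.
Qed.

Lemma x_notin : x \notin <[y]>.
Proof.
apply/negP => xy; have : G \subset <[y]>.
  by rewrite GE gen_subG subUset !sub1set xy cycle_id.
by move/subset_leq_card; rewrite cG -orderE order_y; move: n0; clear; lia.
Qed.

Lemma n_dvd_exponent : n %| exponent G.
Proof. by rewrite -order_y; apply: dvdn_exponent yG. Qed.

(** For even [s], conjugation by [x] would send y^(n/2) to y^(s n/2) = 1. *)
Lemma s_odd : odd (absz (s %% n%:Z)%Z).
Proof.
set s0 := absz _; apply/negPn/negP => even_s.
have [m sE] : exists m, s0 = (2 * m)%N by exists s0./2; rewrite mul2n -[LHS]odd_double_half (negPf even_s).
have [m' nE] : exists m', n = (2 * m')%N by exists n./2; rewrite mul2n -[LHS]odd_double_half (negPf even_n).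
have yj : (y ^+ m') ^ x = 1.
  rewrite conjXg conjgE mulgA -mulgA yx mulKg -expgM -/s0 sE mulnC mulnA (mulnC m') -nE.
  by rewrite expgM yn expg1n.
have : y ^+ m' = 1 by apply/eqP; rewrite -(conjg_eq1 _ x) yj.
move/eqP; rewrite -order_dvdn order_y => /dvdn_leq; move: n0; rewrite nE; clear; lia.
Qed.

Lemma coset_sq v : (x * y ^+ v) ^+ 2 = y ^+ (n %/ 2 + (absz (s %% n%:Z)%Z).+1 * v).
Proof.
have yxv : y ^+ v * x = x * y ^+ (absz (s %% n%:Z)%Z * v).
  elim: v => [|v IHv]; first by rewrite muln0 mul1g mulg1.
  by rewrite expgSr -mulgA yx mulgA IHv -mulgA -expgD mulnS addnC.
rewrite expgS expg1 mulgA -(mulgA x) yxv !mulgA -expg2 x2 -!expgD.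
by congr (_ ^+ _); rewrite mulSn addnAC addnA.
Qed.

(** Squares of elements of x<y> are even powers of [y], since n/2 and s + 1 are even. *)
Lemma exponent4 : n %% 4 = 0%N -> exponent G = n.
Proof.
move=> n4; apply/eqP; rewrite eqn_dvd n_dvd_exponent andbT; apply/exponentP => g /normal_form[[u v] ->] /=.
have [m nE] : exists m, n = (m * 4)%N by apply/dvdnP/eqP.
case: u; last by rewrite expg0 mul1g -expgM mulnC expgM yn expg1n.
rewrite expg1 {1}(_ : n = 2 * (2 * m))%N; last by rewrite nE; clear; lia.
rewrite expgM coset_sq -expgM; apply/eqP; rewrite -order_dvdn order_y.
have [t ->] : exists t, (absz (s %% n%:Z)%Z).+1 = (t * 2)%N.
  by apply/dvdnP; rewrite dvdn2 /= s_odd.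
rewrite (_ : n %/ 2 = m * 2)%N; last by rewrite nE (_ : m * 4 = m * 2 * 2)%N ?mulnK // -mulnA.
by apply/dvdnP; exists (m + t * v)%N; rewrite {1}nE; clear; lia.
Qed.

(** The exponent is [n] or 2n, and x^n = y^(m * m) with m = n/2 odd is not 1. *)
Lemma exponent2 : n %% 4 != 0%N -> exponent G = (2 * n)%N.
Proof.
move=> n4; have : exponent G %| 2 * n by rewrite -cG exponent_dvdn.
have [m nE] : exists m, n = (2 * m)%N by exists n./2; rewrite mul2n -[LHS]odd_double_half (negPf even_n).
have odd_m : odd m by move: n4; rewrite nE; clear; lia.
have n2E : n %/ 2 = m by rewrite nE mulKn.
have [t tE] := dvdnP n_dvd_exponent; have xe : x ^+ exponent G = 1 by apply: expg_exponent xG.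
rewrite tE dvdn_pmul2r // => t2.
have t12 : t = 1%N \/ t = 2%N.
  by have := dvdn_leq (isT : 0 < 2) t2; case: t t2 {tE} => [|[|[|]]] //; [left|right].
case: t12 => t1; last by rewrite t1.
move: xe; rewrite tE t1 mul1n {1}nE expgM x2 n2E -expgM => /eqP.
rewrite -order_dvdn order_y nE => /dvdnP[z zE]; exfalso.
have : odd (m * m) by rewrite oddM odd_m.
by rewrite zE !oddM andbF.
Qed.

Lemma prod_cycle (t : seq gT) : all (mem <[y]>) t -> \prod_(g <- t) g \in <[y]>.
Proof. by move/allP => ty; rewrite big_seq; apply: group_prod => g /ty. Qed.

Definition extremal (p : nat) : seq gT := nseq p 1 ++ nseq n.-1 y ++ [:: x].

Lemma size_extremal p : size (extremal p) = (p + n)%N.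
Proof. by rewrite !size_cat !size_nseq /= addn1 prednK. Qed.

Lemma extremal_over p : seq_over G (extremal p).
Proof.
by rewrite /seq_over !all_cat !all_nseq /= xG yG group1 !orbT.
Qed.

(** A single [x] would put the product outside <y>, and between 1 and n - 1 factors [y] do not
    multiply to 1; only the ones remain. *)
Lemma extremal_product_one p T : subseq_of T (extremal p) -> product_one T -> size T <= p.
Proof.
case=> m TE [t [tT prodt]].
have xny : x != y by apply: contraNneq x_notin => ->; apply: cycle_id.
have xn1 : x != 1 by apply: contraNneq x_notin => ->; apply: group1.
have yn1 : y != 1 by rewrite -order_eq1 order_y; move: n8; clear; case: n => [|[|]].
have cnt P : count P t <= count P (extremal p).
  by rewrite (seq.permP tT) TE; apply: leq_count_subseq; apply: mask_subseq.
have memt g : g \in t -> [|| g == 1, g == y | g == x].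
  rewrite (perm_mem tT) TE => /mem_mask; rewrite !mem_cat !mem_nseq mem_seq1.
  by case/or3P => [/andP[_ ->]|/andP[_ ->]|->]; rewrite ?orbT.
have cyc t' : {subset t' <= t} -> x \notin t' -> all (mem <[y]>) t'.
  move=> sub xt'; apply/allP => g gt'; case/or3P: (memt g (sub g gt')) => /eqP gE; rewrite gE /=.
  - exact: group1.
  - exact: cycle_id.
  - by rewrite -gE gt' in xt'.
have cx : count_mem x t <= 1.
  apply: leq_trans (cnt _) _; rewrite !count_cat !count_nseq /= eqxx.
  by rewrite eq_sym (negPf xn1) eq_sym (negPf xny).
have xt : x \notin t.
  apply/negP => /splitPr tE; case: tE prodt cx cyc => t1 t2.
  rewrite count_cat /= eqxx add1n addnS ltnS leqn0 addn_eq0 big_cat big_cons /= => prodt /andP[/eqP c1 /eqP c2] cyc.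
  have xt1 : x \notin t1 by apply/count_memPn.
  have xt2 : x \notin t2 by apply/count_memPn.
  have p1 : \prod_(g <- t1) g \in <[y]>.
    by apply: prod_cycle; apply: cyc => // g gt1; rewrite mem_cat gt1.
  have p2 : \prod_(g <- t2) g \in <[y]>.
    by apply: prod_cycle; apply: cyc => // g gt2; rewrite mem_cat inE gt2 !orbT.
  have /negP := x_notin; apply.
  have := group1 <[y]>; rewrite -prodt => h.
  by move: h; rewrite groupMl // groupMr.
have prodE : \prod_(g <- t) g = y ^+ count_mem y t.
  have : {in t, forall g, (g == 1) || (g == y)}.
    move=> g gt; case/or3P: (memt g gt) => [->|->|/eqP gx]; rewrite ?orbT //.
    by rewrite -gx gt in xt.
  elim: (t) => [|g t' IHt] tg; first by rewrite big_nil.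
  rewrite big_cons IHt => [|g' g't]; last by apply: tg; rewrite inE g't orbT.
  case/orP: (tg g (mem_head _ _)) => /eqP -> /=; last by rewrite eqxx expgS.
  by rewrite mul1g eq_sym (negPf yn1).
have cy : count_mem y t = 0%N.
  have le_n : count_mem y t < n.
    apply: leq_ltn_trans (cnt _) _; rewrite !count_cat !count_nseq /= eqxx.
    rewrite eq_sym (negPf yn1) (negPf xny) /= mul0n mul1n add0n addn0.
    by rewrite addn0 prednK.
  move/eqP: prodt; rewrite prodE -order_dvdn order_y; case: (count_mem y t) le_n => // k kn.
  by move/(dvdn_leq (ltn0Sn _)); rewrite leqNgt kn.
have <- : count_mem 1 t = size T.
  rewrite -(perm_size tT); apply/eqP; rewrite -all_count; apply/allP => g gt /=.
  case/or3P: (memt g gt) => // /eqP gE; last by rewrite -gE gt in xt.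
  by move/count_memPn: cy; rewrite -gE gt.
apply: leq_trans (cnt _) _; rewrite !count_cat !count_nseq /= eqxx (negPf yn1) (negPf xn1).
by rewrite mul1n mul0n addn0 addn0.
Qed.

(** The indices are positions in [S], so that equal group elements stay distinct. *)
Lemma fixed_length_of_realizes (N r : nat) :
    (forall (I : finType) (c : pred I) (a : I -> int), N <= #|I| ->
       exists T : {set I}, #|T| = r /\ realizes_multiple c a n s n T) ->
  forall S, seq_over G S -> N <= size S -> has_k_product_one r S.
Proof.
move=> H S GS leS.
have nfS (i : 'I_(size S)) : exists u : bool * nat, nth 1 S i = x ^+ u.1 * y ^+ u.2.
  by apply: normal_form; apply: (allP GS); apply: mem_nth.
have [f fE] := fin_all_exists nfS.
have [|T [cT [v rv nv]]] := H _ (fun i => (f i).1) (fun i => Posz (f i).2); first by rewrite card_ord.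
have [t [ut tT prodt]] := realizes_prod n0 x2 yn yx rv.
have termE i : term x y n (fun i => (f i).1) (fun i => Posz (f i).2) i = nth 1 S i.
  by rewrite /term (zpow_nat yn) fE.
have v1 : zpow y n v = 1.
  by rewrite (@zpow_eqmod _ y n v (Posz 0)) ?(zpow_nat yn 0) // GRing.subr0.
pose A := [seq i <- enum 'I_(size S) | i \in T].
have SE : S = [seq nth 1 S (i : 'I_(size S)) | i <- enum 'I_(size S)].
  by rewrite -[LHS](mkseq_nth 1) /mkseq -val_enum_ord -map_comp.
have tA : perm_eq t A.
  apply: uniq_perm => // [|i]; first by rewrite filter_uniq // enum_uniq.
  by rewrite tT mem_filter mem_enum andbT.
exists [seq nth 1 S (i : 'I_(size S)) | i <- A]; split.
  exists [seq i \in T | i <- enum 'I_(size S)].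
  by rewrite [X in mask _ X]SE -map_mask -filter_mask.
split; first by rewrite size_map -(perm_size tA) -cT -(card_uniqP ut); apply: eq_card.
exists [seq nth 1 S (i : 'I_(size S)) | i <- t]; split; first exact: perm_map.
by rewrite big_map -[RHS]v1 -prodt; apply: eq_bigr => i _; rewrite termE.
Qed.

Lemma fixed_length_lower r m : 0 < r ->
  (forall S, seq_over G S -> m <= size S -> has_k_product_one r S) -> n + r <= m.
Proof.
move=> r0 H; rewrite leqNgt; apply/negP => lt.
have [|T [TS [szT oneT]]] := H _ (extremal_over r.-1).
  by rewrite size_extremal; move: lt r0; clear; lia.
by have := extremal_product_one TS oneT; rewrite szT; move: r0; clear; lia.
Qed.

(** Both cases share s(G) = n + exp(G). Its upper bound gives short product-one subsequences among n
    + 1 terms, hence the bounds for eta and d. *)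
Lemma invariants_of_upper r : exponent G = r ->
  (forall S, seq_over G S -> n + r <= size S -> has_k_product_one r S) ->
  (forall S, seq_over G S -> 3 * n <= size S -> has_k_product_one (2 * n) S) ->
  [/\ is_davenport G n, is_eta G n.+1, is_s G (n + r) & is_E G (3 * n)].
Proof.
move=> er up_r up_2n; have r0 : 0 < r by rewrite -er exponent_gt0.
have short : forall S, seq_over G S -> n.+1 <= size S ->
    exists T, subseq_of T S /\ 1 <= size T <= r /\ product_one T.
  apply: (short_of_fixed_length r0 _ (group1 G) up_r).
  by move: r0; clear; lia.
have free0 T : subseq_of T (extremal 0) -> 0 < size T -> ~ product_one T.
  by move=> TS T0 /(extremal_product_one TS); rewrite leqNgt T0.
split.
- split; first by exists (extremal 0); rewrite size_extremal; split; first exact: extremal_over.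
  move=> S GS freeS; rewrite leqNgt; apply/negP => lt.
  have [T [TS [/andP[T0 _] oneT]]] := short S GS lt; exact: freeS TS T0 oneT.
- split=> [S GS leS|m H]; first by rewrite /has_short_product_one er; apply: short.
  rewrite ltnNge; apply/negP => le_m.
  have [|T [TS [/andP[T0 _] oneT]]] := H _ (extremal_over 0); first by rewrite size_extremal.
  exact: free0 TS T0 oneT.
- split; rewrite er; first exact: up_r.
  by move=> m; apply: fixed_length_lower.
split; rewrite cG; first exact: up_2n.
move=> m H; have := @fixed_length_lower (2 * n) m _ H; rewrite muln_gt0 n0 -mulSn; exact.
Qed.

End Metacyclic.

(** * Splitting n/2 according to the residue of s *)

Section Arithmetic.
Import GRing.Theory Num.Theory.
Local Open Scope ring_scope.

(** Take k = gcd(n/2, s - 1). The cofactor [l] is prime to (s - 1)/k, hence divides s + 1. A common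
    divisor of [k] and [l] divides 2 and is odd. The conditions on [s] exclude k = 1 and l = 1. *)
Lemma split_odd_part (n : nat) (s : int) : ~~ odd n -> (n %% 4)%N != 0%N ->
    (n %| s ^+ 2 - 1)%Z -> ~~ (n %| s - 1)%Z -> ~~ (n %| s + 1)%Z ->
  exists k l : nat, [/\ odd k, odd l, (2 < k)%N, (2 < l)%N & coprime k l] /\
    [/\ n = (2 * (k * l))%N, (l %| s + 1)%Z & ((2 * k)%N %| s - 1)%Z].
Proof.
move=> even_n n4 s2 s1 sm1.
have [m nE] : exists m, n = (2 * m)%N by exists n./2; move: even_n; clear; lia.
have odd_m : odd m by move: n4; rewrite nE; clear; lia.
have sE : s ^+ 2 - 1 = (s - 1) * (s + 1) by ring.
have s_2 : (2 %| s - 1)%Z.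
  have : (2 %| s ^+ 2 - 1)%Z by apply: dvdz_trans s2; rewrite nE dvdzE /= dvdn_mulr.
  rewrite sE dvdzE abszM Euclid_dvdM // -[X in X || _]/(2 %| s - 1)%Z -[X in _ || X]/(2 %| s + 1)%Z.
  case/orP => // h; have -> : s - 1 = (s + 1) - 2 by ring.
  exact: rpredB.
have two_mul (d : nat) (z : int) : odd d -> ((2 * d)%N %| z)%Z = (2 %| z)%Z && (d %| z)%Z.
  by move=> od; rewrite PoszM Gauss_dvdz // coprimezE; apply: (etrans (coprime2n d) od).
have s_2' : (2 %| s + 1)%Z.
  have -> : s + 1 = (s - 1) + 2 by ring.
  exact: rpredD.
pose k := gcdn m (absz (s - 1)%R); have km : (k %| m)%N by apply: dvdn_gcdl.
have ks : (k %| s - 1)%Z by rewrite dvdzE; apply: dvdn_gcdr.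
have m0 : (0 < m)%N by move: odd_m; clear; case: m.
have k0 : (0 < k)%N by rewrite gcdn_gt0 m0.
have [l mE'] := dvdnP km; have mE : m = (k * l)%N by rewrite mulnC.
have /andP[odd_k odd_l] : odd k && odd l by rewrite -oddM -mE.
have [t tE] := dvdzP ks.
have cop_lt : coprimez l t.
  have gE : (gcdn l (absz t) * k = k)%N.
    by rewrite muln_gcdl -mE' (_ : absz t * k = absz (s - 1)%R)%N // tE abszM.
  by rewrite coprimezE /coprime /= -(eqn_pmul2r k0) gE mul1n.
have ls : (l %| s + 1)%Z.
  rewrite -(Gauss_dvdzr _ cop_lt).
  have : ((l * k)%N %| s ^+ 2 - 1)%Z by apply: dvdz_trans s2; rewrite nE mE' dvdzE /= dvdn_mull.
  have -> : s ^+ 2 - 1 = t * (s + 1) * k%:Z by rewrite sE tE; ring.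
  by rewrite PoszM dvdz_mul2r //; move: k0; clear; lia.
exists k, l; split; split=> //.
- case: k odd_k k0 tE mE mE' {km ks cop_lt} => [|[|[|]]] //= _ _ _ mE _.
  by case/negP: sm1; rewrite nE two_mul // s_2' mE mul1n.
- case: l odd_l mE {mE' cop_lt ls} => [|[|[|]]] //= _ mE.
  by case/negP: s1; rewrite nE two_mul // s_2 mE muln1.
- apply/eqP; rewrite -/(coprime k l); apply/eqP; apply: contraT => /eqP ne1.
  pose d := gcdn k l; have dk : (d %| k)%N := dvdn_gcdl _ _.
  have d2 : (d %| 2)%N.
    have : (d %| (s + 1) - (s - 1))%Z.
      apply: rpredB; first by apply: dvdz_trans ls; rewrite dvdzE /= dvdn_gcdr.
      by apply: dvdz_trans ks; rewrite dvdzE.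
    by have -> : (s + 1) - (s - 1) = 2 by ring.
  have odd_d : odd d by have [z zE] := dvdnP dk; move: odd_k; rewrite zE oddM => /andP[].
  by case: ne1; rewrite -/d; move: d2 odd_d; case: d {dk} => [|[|[|]]] // d /(dvdn_leq isT).
- by rewrite nE mE.
- by rewrite two_mul // s_2.
Qed.

End Arithmetic.

Theorem theorem1p1 (n : nat) (s : int) (gT : finGroupType) (G : {group gT})
    (x y : gT) :
  8 <= n -> ~~ odd n ->
  (s ^+ 2 = 1 %[mod n%:Z])%Z ->
  (s != 1 %[mod n%:Z])%Z -> (s != - 1 %[mod n%:Z])%Z ->
  G :=: <<[set x; y]>> ->
  x ^+ 2 = y ^+ (n %/ 2) -> y ^+ n = 1 ->
  y * x = x * y ^+ (absz (s %% n%:Z)%Z) ->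
  #|G| = (2 * n)%N ->
  [/\ is_davenport G n, is_eta G n.+1,
      is_s G (if n %% 4 == 0 then (2 * n)%N else (3 * n)%N)
    & is_E G (3 * n)%N].
Proof.
move=> n8 even_n s2 s1 sm1 GE x2 yn yx cG.
have n0 : 0 < n by apply: leq_trans n8.
move/eqP: s2; rewrite eqz_mod_dvd => s2; move: s1 sm1; rewrite !eqz_mod_dvd GRing.opprK => s1 sm1.
have upper N r := @fixed_length_of_realizes n s gT G x y n8 GE x2 yn yx N r.
have invariants := invariants_of_upper n8 GE x2 yn yx cG.
case: eqP => [n4|/eqP n4].
  have n4' : 4 %| n by rewrite /dvdn n4.
  rewrite mul2n -addnn; apply: invariants.
  - exact: (exponent4 n8 even_n GE x2 yn yx cG).
  - apply: upper => I c a; rewrite addnn -mul2n -cardsT => leI.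
    by have [T [_ cT rT]] := four_dvd_realizes c a n4' n0 s2 s1 leI; exists T.
  - apply: upper => I c a leI.
    exact: four_dvd_realizes_double leI.
have [k [l [[odd_k odd_l k3 l3 cop] [nE sl sk]]]] := split_odd_part even_n n4 s2 s1 sm1.
have up_2n : forall S, seq_over G S -> 3 * n <= size S -> has_k_product_one (2 * n) S.
  apply: upper => I c a leI.
  exact: (@two_mod_four_realizes I c a n k l s odd_k odd_l k3 l3 cop nE sl sk leI).
have -> : (3 * n = n + 2 * n)%N by rewrite mulSn.
apply: invariants => //; exact: (exponent2 n8 even_n GE x2 yn yx cG).
Qed.
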